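(* Let $A_0,A_1,A_2,\ldots$ be (possibly dependent) complex random variables with $$\sup_k\mathbb{E}[|A_k|]<\infty\quad\text{and}\quad\sup_k\mathrm{Var}[|A_k|]<\infty,$$ and let $P_n(z)=\sum_{k=0}^n A_kz^k$. Suppose also that $\mathbb{E}[\log|A_0|]>-\infty$ and $\mathbb{E}[\log|A_n|]>-\infty$. Let $0<r<1$ and $0\le\alpha<\beta<2\pi$. Then $$\mathbb{E}\left[\left|\tau_n(A_r(\alpha,\beta))-\frac{\beta-\alpha}{2\pi}\right|\right]\le C_r\sqrt{\frac{\frac32\log(n+1)-\frac12\mathbb{E}[\log|A_0|]-\frac12\mathbb{E}[\log|A_n|]+O(1)}{n}}$$ as $n\to\infty$, where $$C_r=\sqrt{\frac{2\pi}{\mathbf{k}}}+\frac{2}{1-r},\qquad\mathbf{k}=\sum_{k=0}^{\infty}\frac{(-1)^k}{(2k+1)^2}\ \text{(Catalan's constant)}.$$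
   Context: For a polynomial $P_n$ of degree $n$ with complex zeros $Z_1,\ldots,Z_n$ (listed with multiplicity), the zero counting measure is $\tau_n=\frac1n\sum_{k=1}^n\delta_{Z_k}$, a random unit Borel measure on $\mathbb{C}$. (The hypotheses imply $A_0A_n\ne0$ almost surely.) The annular sector is $A_r(\alpha,\beta)=\{z\in\mathbb{C}: r<|z|<1/r,\ \alpha\le\arg z<\beta\}$, where $0<r<1$ and $\arg z\in[0,2\pi)$. *)

(* Defs.v *)
From HB Require Import structures.
From mathcomp Require Import all_boot all_order all_algebra.
From mathcomp Require Import all_classical all_reals all_analysis.
From mathcomp Require Import complex.

Set Implicit Arguments.
Unset Strict Implicit.
Unset Printing Implicit Defensive.

Import Order.TTheory GRing.Theory Num.Theory.
Import numFieldNormedType.Exports.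

Local Open Scope classical_set_scope.
Local Open Scope ring_scope.
Local Open Scope complex_scope.

(* The norm [`|z|] of R[i] takes its values in R[i]; this is the real one. *)
Definition cmod (R : realType) (z : R[i]) : R := Normc.normc z.

Definition complex_random_variable (d : measure_display) (T : measurableType d)
    (R : realType) (X : T -> R[i]) : Prop :=
  measurable_fun [set: T] (fun w => complex.Re (X w)) /\
  measurable_fun [set: T] (fun w => complex.Im (X w)).

(* The argument in [0, 2 pi); for z = 0 its value is an arbitrary element of
   this interval. *)
Definition arg (R : realType) (z : R[i]) : R :=
  xget 0 [set t : R | 0 <= t < 2 * pi /\
                      z = (cmod z)%:C * (cos t +i* sin t)].

Lemma argP (R : realType) (z : R[i]) :
  0 <= arg z < 2 * pi /\ z = (cmod z)%:C * (cos (arg z) +i* sin (arg z)).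
Proof.
rewrite /arg; case: xgetP => [_ _ //|tP]; exfalso.
suff [t] : exists t : R, 0 <= t < 2 * pi /\
    z = (cmod z)%:C * (cos t +i* sin t) by exact: tP.
move=> {tP}.
have pi_gt0 : 0 < pi :> R by exact: pi_gt0.
have [->|z0] := eqVneq z 0.
  by exists 0; rewrite /cmod Normc.normc0 mul0r lexx mulr_gt0.
case: z z0 => x y z0.
have n0 : cmod (x +i* y) != 0.
  by apply: contra z0 => /eqP/Normc.eq0_normc ->.
have nsq : cmod (x +i* y) ^+ 2 = x ^+ 2 + y ^+ 2.
  by rewrite /cmod /= sqr_sqrtr// addr_ge0 ?sqr_ge0.
have n_gt0 : 0 < cmod (x +i* y) by rewrite lt_def n0 sqrtr_ge0.
set n := cmod _ in n0 nsq n_gt0 *.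
have u1 : (x / n) ^+ 2 + (y / n) ^+ 2 = 1.
  by rewrite !expr_div_n -mulrDl -nsq divff// expf_neq0.
have xn : -1 <= x / n <= 1.
  by rewrite -ler_norml -(@ler_pXn2r _ 2) ?nnegrE// expr1n real_normK
    ?num_real// -u1 lerDl sqr_ge0.
have s2 : Num.sqrt (1 - (x / n) ^+ 2) = `|y| / n.
  by rewrite -u1 addrC addKr sqrtr_sqr normrM normfV (gtr0_norm n_gt0).
have polar t : cos t = x / n -> sin t = y / n ->
    x +i* y = n%:C * (cos t +i* sin t).
  by move=> -> ->; simpc; rewrite ![n * _]mulrC !divfK.
have [y0|y0] := leP 0 y.
  exists (acos (x / n)); split; last first.
    by apply: polar; rewrite ?acosK// sin_acos// s2 ger0_norm.
  rewrite acos_ge0//= (le_lt_trans (acos_lepi xn))// mulr_natl mulr2n.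
  by rewrite ltrDl.
exists (2 * pi - acos (x / n)); split; last first.
  apply: polar; rewrite mulr_natl addrC.
    by rewrite cosD2pi cosN acosK.
  by rewrite sinD2pi sinN sin_acos// s2 ltr0_norm// mulNr opprK.
have xn1 : x / n < 1.
  rewrite lt_neqAle (andP xn).2 andbT; apply: contraTneq y0 => xn1.
  move: u1; rewrite xn1 expr1n -[RHS]addr0 => /addrI/eqP.
  by rewrite sqrf_eq0 mulf_eq0 invr_eq0 (negbTE n0) orbF => /eqP ->; rewrite ltxx.
have a_gt0 : 0 < acos (x / n) by apply: acos_gt0; rewrite (andP xn).1.
rewrite subr_ge0 gtrBl a_gt0 andbT (le_trans (acos_lepi xn))// mulr_natl mulr2n.
by rewrite lerDl ltW.
Qed.

Definition annular_sector (R : realType) (r a b : R) : set R[i] :=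
  [set z | r < cmod z < r^-1 /\ a <= arg z < b].

Definition random_poly (R : realType) (T : Type) (A : nat -> T -> R[i])
    (n : nat) (w : T) : {poly R[i]} :=
  \sum_(k < n.+1) A k w *: 'X^k.

(* For p != 0, the zeros of p listed with multiplicity:
   p = lead_coef p *: \prod_(z <- zeros p) ('X - z%:P). *)
Definition zeros (R : realType) (p : {poly R[i]}) : seq R[i] :=
  sval (closed_field_poly_normal p).

(* \1_S z is the mass that the Dirac measure at z gives to S. *)
Definition zero_counting_measure (R : realType) (p : {poly R[i]})
    (S : set R[i]) : R :=
  (size p).-1%:R^-1 * \sum_(z <- zeros p) \1_S z.

(* E[log|X|], with log 0 = -oo. *)
Definition expectation_log_cmod (d : measure_display) (T : measurableType d)
    (R : realType) (P : probability T R) (X : T -> R[i]) : \bar R :=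
  (\int[P]_w lne (cmod (X w))%:E)%E.

Definition catalan (R : realType) : R :=
  limn (series (fun k : nat => (-1) ^+ k / (2 * k + 1)%N%:R ^+ 2 : R)).

Definition sector_constant (R : realType) (r : R) : R :=
  Num.sqrt (2 * pi / catalan R) + 2 / (1 - r).

(* Main.v *)
Require Import Defs.
From HB Require Import structures.
From mathcomp Require Import all_boot all_order all_algebra.
From mathcomp Require Import all_classical all_reals all_analysis.
From mathcomp Require Import complex.
From mathcomp Require Import measurable_realfun ring lra zify.

(** The discrepancy is controlled by one number. For a polynomial of degree n with
    coefficients a_k and a_0 a_n <> 0, put S = sum |a_k| and
    H = log (S / sqrt |a_0 a_n|) >= 0. Deterministically,
      |tau_n(A_r(a, b)) - (b - a)/(2 pi)| <= C_r sqrt (H / n)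
    ([annular_sector_discrepancy]), and the theorem follows by taking
    expectations.

    Zeros leave the annulus rarely. Reflecting zeros in the unit circle keeps the
    modulus on the circle and shows that the Mahler measure is at most S
    ([mahler_measure_le]); hence the sum of |log|z|| over the zeros is at most 2H,
    and at most 2H/(1 - r) zeros lie outside the annulus.

    Their arguments are equidistributed. Moving the zeros radially to the unit
    circle decreases |P| there, up to the factor sqrt |a_0 a_n|
    ([radial_projection_le]), so the polynomial Q with the projected zeros is
    at most e^H on the circle, hence in the disk ([maximum_principle]). The log
    of |Q| is harmonic in the disk, vanishes at the origin and is at most H, which
    bounds its Taylor coefficients: the k-th power sum of the projected zeros is
    at most 2kH ([power_sum_le]). Smoothing the indicator of an arc by two boxes
    of relative width t turns this into the bound 2t + H/(nt) on the angular
    discrepancy ([arc_count_le]), that is 3 sqrt (H/n) at t = sqrt (H/n). All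
    averages over the circle are sums over roots of unity: the angles are first
    rounded to a grid of m points, and m tends to infinity.

    With x = H/n the total is at most 3 sqrt x + 2x/(1 - r). Catalan's constant is
    at most 1, so C_r >= 2 + 2/(1 - r), and this suffices: either C_r sqrt x >= 1
    and there is nothing to prove, or sqrt x < 1/4 and the surplus
    (2/(1 - r)) (1 - sqrt x) >= 3/2 exceeds the missing 1 ([trade_off_le]).

    For the expectation, the concave functions sqrt and log are replaced by
    tangent lines ([discrepancy_le_affine]), so that only E|A_k|, E[log|A_0|] and
    E[log|A_n|] enter, whatever the dependence between the coefficients. Bounded
    means give E[S] = O(n), hence log E[S] = log (n+1) + O(1), which is below
    (3/2) log (n+1) + O(1). *)

Set Implicit Arguments.
Unset Strict Implicit.
Unset Printing Implicit Defensive.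

Import Order.TTheory GRing.Theory Num.Theory.
Import numFieldNormedType.Exports.

Local Open Scope classical_set_scope.
Local Open Scope ring_scope.

(** * Modulus and unit complex numbers *)

Section Cmod.
Local Open Scope complex_scope.
Variable R : realType.
Implicit Types (z : R[i]) (x t : R).

Lemma norm_cmod z : `|z| = (cmod z)%:C. Proof. by []. Qed.

Lemma cmod_ge0 z : 0 <= cmod z.
Proof. by case: z => a b; exact: sqrtr_ge0. Qed.

Lemma cmod0 : cmod (0 : R[i]) = 0. Proof. exact: Normc.normc0. Qed.

Lemma cmod1 : cmod (1 : R[i]) = 1. Proof. exact: Normc.normc1. Qed.

Lemma cmodM z1 z2 : cmod (z1 * z2) = cmod z1 * cmod z2.
Proof. exact: Normc.normcM. Qed.

Lemma cmodN z : cmod (- z) = cmod z. Proof. exact: normcN. Qed.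

Lemma cmodB z1 z2 : cmod (z1 - z2) = cmod (z2 - z1).
Proof. by rewrite -cmodN opprB. Qed.

Lemma le_cmodD z1 z2 : cmod (z1 + z2) <= cmod z1 + cmod z2.
Proof. exact: le_normcD. Qed.

Lemma cmod_eq0 z : (cmod z == 0) = (z == 0).
Proof. by apply/eqP/eqP => [/Normc.eq0_normc|->]//; rewrite cmod0. Qed.

Lemma cmod_gt0 z : (0 < cmod z) = (z != 0).
Proof. by rewrite lt_def cmod_ge0 andbT cmod_eq0. Qed.

Lemma cmodX z n : cmod (z ^+ n) = cmod z ^+ n.
Proof. by elim: n => [|n IH]; rewrite ?expr0 ?cmod1// !exprS cmodM IH. Qed.

Lemma cmod_real x : cmod x%:C = `|x|.
Proof. by rewrite /cmod /= expr0n addr0 sqrtr_sqr. Qed.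

Lemma cmod_nat n : cmod (n%:R : R[i]) = n%:R.
Proof. by rewrite -(rmorph_nat (real_complex R)) cmod_real normr_nat. Qed.

Lemma cmod_conj z : cmod (conjc z) = cmod z.
Proof. by case: z => a b; rewrite /cmod /= sqrrN. Qed.

Lemma cmod_sqr (a b : R) : cmod (a +i* b) ^+ 2 = a ^+ 2 + b ^+ 2.
Proof. by rewrite /cmod /= sqr_sqrtr// addr_ge0 ?sqr_ge0. Qed.

Lemma le_cmod_sum I (r : seq I) (P : pred I) (F : I -> R[i]) :
  cmod (\sum_(i <- r | P i) F i) <= \sum_(i <- r | P i) cmod (F i).
Proof.
elim/big_rec2: _ => [|i y z _ IH]; first by rewrite cmod0.
by rewrite (le_trans (le_cmodD _ _))// lerD2l.
Qed.

Lemma cmod_prod I (r : seq I) (P : pred I) (F : I -> R[i]) :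
  cmod (\prod_(i <- r | P i) F i) = \prod_(i <- r | P i) cmod (F i).
Proof. exact: (big_morph _ cmodM cmod1). Qed.

Lemma sum_conj I (r : seq I) (P : pred I) (F : I -> R[i]) :
  conjc (\sum_(i <- r | P i) F i) = \sum_(i <- r | P i) conjc (F i).
Proof. exact: raddf_sum. Qed.

(** The unit complex number exp(i t). *)
Definition cis t : R[i] := cos t +i* sin t.

Lemma cmod_cis t : cmod (cis t) = 1.
Proof.
apply/eqP; rewrite -(@eqrXn2 _ 2) ?cmod_ge0//.
by rewrite cmod_sqr cos2Dsin2 expr1n.
Qed.

Lemma cis0 : cis 0 = 1. Proof. by rewrite /cis cos0 sin0. Qed.

Lemma cisD s t : cis (s + t) = cis s * cis t.
Proof. by rewrite /cis cosD sinD; simpc; congr (_ +i* _); rewrite addrC mulrC. Qed.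

Lemma cisN t : cis (- t) = conjc (cis t).
Proof. by rewrite /cis cosN sinN. Qed.

Lemma cis_neq0 t : cis t != 0.
Proof. by rewrite -cmod_gt0 cmod_cis. Qed.

Lemma cisMn n t : cis (n%:R * t) = cis t ^+ n.
Proof.
elim: n => [|n IH]; first by rewrite mul0r cis0.
by rewrite -[n.+1]add1n natrD mulrDl mul1r cisD IH exprS.
Qed.

Lemma cis2pi : cis (2 * pi) = 1.
Proof. by rewrite /cis mulr_natl cos2pi sin2pi. Qed.

Lemma cis_conjV t : conjc (cis t) = (cis t)^-1.
Proof.
apply: (mulfI (cis_neq0 t)); rewrite divff ?cis_neq0// -cisN -cisD subrr.
exact: cis0.
Qed.

Lemma cmod_1Bcis t : cmod (1 - cis t) = 2 * `|sin (t / 2)|.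
Proof.
apply/eqP; rewrite -(@eqrXn2 _ 2) ?cmod_ge0 ?mulr_ge0//.
rewrite [1 - _](_ : _ = (1 - cos t) +i* (- sin t)); last by rewrite /cis; simpc.
rewrite cmod_sqr exprMn real_normK ?num_real// sin2cos2.
have ht : t = (t / 2) *+ 2 by rewrite -mulr_natr divfK.
rewrite sqrrN sin2cos2 [in X in X == _]ht cos_mulr2n.
by apply/eqP; ring.
Qed.

Lemma sin_le x : 0 <= x -> sin x <= x.
Proof.
move=> x0.
have [c _] := @MVT_segment R sin cos 0 x x0 (fun y _ => is_derive_sin y)
  (continuous_subspaceT (@continuous_sin R)).
rewrite sin0 !subr0 => ->.
by rewrite ler_piMl// cos_le1.
Qed.

Lemma abs_sin_le x : `|sin x| <= `|x|.
Proof.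
have key (y : R) : 0 <= y -> `|sin y| <= y.
  move=> y0; have [y1|y1] := leP y 1.
    have sy : 0 <= sin y.
      by apply: sin_ge0_pi; rewrite y0/=; have := pi_ge2 R; lra.
    by rewrite ger0_norm// sin_le.
  by rewrite (le_trans (sin_max _))// ltW.
have [x0|x0] := leP 0 x; first by rewrite [leRHS]ger0_norm// key.
by rewrite -normrN -sinN [leRHS]ltr0_norm// key// oppr_ge0 ltW.
Qed.

Lemma cmod_cisB s t : cmod (cis s - cis t) <= `|s - t|.
Proof.
rewrite -[s in cis s](subrK t) cisD -{2}[cis t]mul1r -mulrBl cmodM cmod_cis mulr1.
rewrite cmodB cmod_1Bcis (le_trans (ler_wpM2l _ (abs_sin_le _)))//.
by rewrite normrM normfV (ger0_norm (_ : 0 <= 2))// mulrC divfK.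
Qed.

(** Concavity of sin on [0, pi/2]: if sin were below its chord at x, the mean value
    theorem on both sides of x would contradict the monotonicity of cos. *)
Lemma jordan_sin x : 0 <= x <= pi / 2 -> 2 / pi * x <= sin x.
Proof.
move=> /andP[]; rewrite le_eqVlt => /predU1P[<-|x0].
  by rewrite mulr0 sin0.
rewrite le_eqVlt => /predU1P[->|xpi].
  by rewrite sin_pihalf mulrA divfK ?divff// gt_eqF ?pi_gt0.
have ct u v := continuous_subspaceT (@continuous_sin R) : 
  {within `[u, v], continuous (@sin R)}.
have [c1 /[!in_itv]/= /andP[c10 c1x] e1] := MVT x0 (fun y _ => is_derive_sin y) (ct _ _).
have [c2 /[!in_itv]/= /andP[xc2 c2p] e2] := MVT xpi (fun y _ => is_derive_sin y) (ct _ _).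
move: e1 e2; rewrite sin0 !subr0 sin_pihalf => e1 e2.
have pi0 := @pi_gt0 R.
have hp : pi / 2 <= pi :> R by lra.
have cc : cos c2 < cos c1 :> R.
  rewrite ltr_cos ?in_itv/=; [exact: lt_trans xc2|lra|lra].
rewrite leNgt; apply/negP => h.
have h1 : cos c1 < 2 / pi by rewrite e1 ltr_pM2r// in h.
have h2 : 1 - sin x < 2 / pi * (pi / 2 - x).
  by rewrite e2 ltr_pM2r ?subr_gt0// (lt_trans cc).
have e3 (p : R) : 0 < p -> 2 / p * (p / 2 - x) = 1 - 2 / p * x.
  by move=> p0; field; exact: lt0r_neq0.
have : sin x < sin x by move: h2; rewrite e3//; lra.
by rewrite ltxx.
Qed.

(** This linear growth in k of the denominator of a geometric sum compensates the
    linear growth in k of the power sums. *)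
Lemma chord_ge (m k : nat) : (0 < m)%N -> (2 * k <= m)%N ->
  4 * k%:R / m%:R <= cmod (1 - cis (2 * pi / m%:R * k%:R)) :> R.
Proof.
move=> m0 km; have m0' : 0 < m%:R :> R by rewrite ltr0n.
have pi0 := @pi_gt0 R.
rewrite cmod_1Bcis; set t := _ / 2.
have tE : t = pi * (k%:R / m%:R) by rewrite /t; field; rewrite gt_eqF.
have q0 : 0 <= k%:R / m%:R :> R by rewrite divr_ge0.
have q1 : k%:R / m%:R <= 1 / 2 :> R.
  rewrite ler_pdivrMr// mulrAC ler_pdivlMr// mul1r -natrM ler_nat mulnC.
  by [].
have t0 : 0 <= t <= pi / 2.
  by rewrite tE mulr_ge0 ?pi_ge0//= -[pi / 2]mulr1 mulrAC -mulrA ler_pM2l// mul1r -div1r.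
rewrite -mulrA; apply: le_trans (ler_wpM2l _ (ler_norm _)) => //.
apply: le_trans (ler_wpM2l _ (jordan_sin t0)) => //.
rewrite tE le_eqVlt; apply/orP; left; apply/eqP; move: (pi : R) pi0 => p p0.
by field; rewrite !lt0r_neq0.
Qed.
End Cmod.

(** * Averages over roots of unity and the maximum principle *)

Lemma unity_root_sum (F : fieldType) (m : nat) (w : F) (k : nat) :
  m.-primitive_root w ->
  \sum_(l < m) (w ^+ k) ^+ l = (if (m %| k)%N then m%:R else 0).
Proof.
move=> w_prim; have [mk|mk] := boolP (m %| k)%N.
  have -> : w ^+ k = 1 by apply/eqP; rewrite -(prim_order_dvd w_prim).
  by under eq_bigr do rewrite expr1n; rewrite sumr_const card_ord.
have wk1 : w ^+ k - 1 != 0 by rewrite subr_eq0 -(prim_order_dvd w_prim).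
apply: (mulfI wk1); rewrite mulr0 -subrX1 -exprM mulnC exprM.
by rewrite (prim_expr_order w_prim) expr1n subrr.
Qed.

Lemma powers_dominated (R : archiRealFieldType) (u v c : R) :
  0 <= v -> 0 < c -> (forall s : nat, c * u ^+ s <= v ^+ s) -> u <= v.
Proof.
move=> v0 c0 h; rewrite leNgt; apply/negP => vu.
have u0 : 0 < u by apply: le_lt_trans vu.
have bern (x : R) s : 0 <= x -> 1 + s%:R * x <= (1 + x) ^+ s.
  move=> x0; elim: s => [|s IH]; first by rewrite mul0r addr0.
  rewrite exprS (le_trans _ (ler_wpM2l _ IH)) ?addr_ge0//.
  rewrite -natr1 -subr_ge0 (_ : _ - _ = s%:R * x ^+ 2); last by ring.
  by rewrite mulr_ge0 ?sqr_ge0.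
have [v_eq0|v_neq0] := eqVneq v 0.
  by have := h 1%N; rewrite v_eq0 !expr1 leNgt mulr_gt0.
have {v0 v_neq0} v0 : 0 < v by rewrite lt_def v_neq0.
pose x := u / v - 1.
have x0 : 0 < x by rewrite subr_gt0 ltr_pdivlMr// mul1r.
pose s := Num.bound (c^-1 / x).
have := archi_boundP (ltW (divr_gt0 (_ : 0 < c^-1) x0)).
rewrite invr_gt0 => /(_ c0); rewrite ltr_pdivrMr// -/s => sP.
have := h s; rewrite mulrC -ler_pdivlMr//; apply/negP; rewrite -ltNge.
have -> : u ^+ s = v ^+ s * (1 + x) ^+ s.
  by rewrite -exprMn /x addrC subrK mulrC divfK// gt_eqF.
rewrite ltr_pM2l ?exprn_gt0// (lt_le_trans sP)// (le_trans _ (bern _ _ (ltW x0)))//.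
by rewrite lerDr.
Qed.

Section CircleToDisk.
Local Open Scope complex_scope.
Variable R : realType.
Implicit Types (p : {poly R[i]}) (z : R[i]) (B : R).

Definition unity_root m : R[i] := cis (2 * pi / m%:R).

Lemma unity_root_pow m k : unity_root m ^+ k = cis (2 * pi / m%:R * k%:R) :> R[i].
Proof. by rewrite mulrC cisMn. Qed.

Lemma unity_root_prim m : (0 < m)%N -> m.-primitive_root (unity_root m).
Proof.
move=> m0; have m0' : m%:R != 0 :> R by rewrite pnatr_eq0 -lt0n.
have wm : unity_root m ^+ m = 1 by rewrite unity_root_pow divfK// cis2pi.
have half k : (0 < k)%N -> (2 * k <= m)%N -> unity_root m ^+ k != 1.
  move=> k0 /(chord_ge R m0); rewrite -unity_root_pow => h.
  rewrite eq_sym -subr_eq0 -cmod_gt0 (lt_le_trans _ h)//.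
  by rewrite divr_gt0 ?mulr_gt0 ?ltr0n.
rewrite /primitive_root_of_unity m0; apply/forallP => -[k km] /=; apply/eqP.
rewrite unity_rootE; have [e|ne] := eqVneq k.+1 m; first by rewrite e wm eqxx.
have {ne} km' : (k.+1 < m)%N by rewrite ltn_neqAle ne.
apply/negbTE; have [le2|lt2] := leqP (2 * k.+1) m; first exact: half.
apply: contra (half (m - k.+1)%N _ _) => [/eqP e||]; last 2 first.
- by rewrite subn_gt0.
- by rewrite mulnBr leq_subLR [X in (X <= _)%N]mul2n -addnn leq_add2r ltnW.
by rewrite -[_ ^+ _]mul1r -[X in X * _]e -exprD subnKC ?wm// ltnW.
Qed.

Lemma unity_root_norm m l : cmod (unity_root m ^+ l : R[i]) = 1.
Proof. by rewrite cmodX cmod_cis expr1n. Qed.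

(** Cauchy's formula, with a sum over roots of unity instead of an integral; the
    exponent m - k stands for - k. *)
Lemma coef_unity_avg p m k : (size p <= m)%N -> (k < m)%N ->
  m%:R * p`_k = \sum_(l < m) p.[unity_root m ^+ l] * unity_root m ^+ (l * (m - k)).
Proof.
move=> pm km; have wP := unity_root_prim (leq_ltn_trans (leq0n _) km).
set w := unity_root m in wP *.
transitivity (\sum_(i < m) p`_i * \sum_(l < m) (w ^+ (i + (m - k))) ^+ l); last first.
  under eq_bigr do rewrite big_distrr/=.
  rewrite exchange_big/=; apply: eq_bigr => l _.
  rewrite (horner_coef_wide _ pm) big_distrl/=; apply: eq_bigr => i _.
  by rewrite -mulrA -!exprM -exprD mulnDl [(_ * l)%N]mulnC [(_ * l)%N]mulnC.
rewrite (bigD1 (Ordinal km))//= [X in _ + X]big1 ?addr0 => [|i ik].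
  by rewrite (unity_root_sum _ wP) subnKC ?dvdnn ?(ltnW km)// mulrC.
rewrite (unity_root_sum _ wP) ifN ?mulr0//; apply: contra ik => mik.
apply/eqP/val_inj => /=.
have := ltn_ord i; case/dvdnP: mik => -[|[|q]] e im; lia.
Qed.

Lemma coef_le_circle p B k : (forall z, cmod z = 1 -> cmod p.[z] <= B) ->
  cmod p`_k <= B.
Proof.
move=> pB; pose m := maxn (size p) k.+1.
have km : (k < m)%N by rewrite leq_max leqnn orbT.
have m0 : 0 < m%:R :> R by rewrite ltr0n (leq_ltn_trans _ km).
rewrite -(ler_pM2l m0) -{1}cmod_nat -cmodM (@coef_unity_avg _ m) ?leq_maxl//.
rewrite (le_trans (le_cmod_sum _ _ _))//.
rewrite (le_trans (ler_sum _ (_ : forall l, _ -> _ <= B)))//.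
  by move=> l _; rewrite cmodM unity_root_norm mulr1 pB// unity_root_norm.
by rewrite sumr_const card_ord mulr_natl.
Qed.

Lemma circle_bound_ge0 p B : (forall z, cmod z = 1 -> cmod p.[z] <= B) -> 0 <= B.
Proof. by move=> /(_ 1 (cmod1 R)); apply: le_trans; exact: cmod_ge0. Qed.

(** The coefficient bound loses only a factor independent of the polynomial, and
    that factor disappears when the bound is applied to high powers. *)
Lemma maximum_principle p B z : (forall z, cmod z = 1 -> cmod p.[z] <= B) ->
  cmod z < 1 -> cmod p.[z] <= B.
Proof.
move=> pB z1; have B0 := circle_bound_ge0 pB.
apply: (@powers_dominated _ _ _ (1 - cmod z)) => [//||s]; first by rewrite subr_gt0.
rewrite -cmodX -horner_exp; set q := p ^+ s.
have qB w : cmod w = 1 -> cmod q.[w] <= B ^+ s.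
  by move=> w1; rewrite /q horner_exp cmodX lerXn2r ?nnegrE ?cmod_ge0// pB.
rewrite horner_coef mulrC; apply: le_trans (ler_wpM2r _ (le_cmod_sum _ _ _)) _.
  by rewrite subr_ge0 ltW.
apply: (@le_trans _ _ ((\sum_(i < size q) B ^+ s * cmod z ^+ i) * (1 - cmod z))).
  apply: ler_wpM2r; first by rewrite subr_ge0 ltW.
  apply: ler_sum => i _; rewrite cmodM cmodX ler_wpM2r ?exprn_ge0 ?cmod_ge0//.
  exact: coef_le_circle.
rewrite -big_distrr/= -mulrA [X in _ * X]mulrC -opprB mulNr -subrX1 opprB.
by rewrite ler_piMr ?exprn_ge0// gerBl exprn_ge0 ?cmod_ge0.
Qed.
End CircleToDisk.

(** * The logarithm of a chord *)

Section LogSeries.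
Local Open Scope complex_scope.
Variable R : realType.
Implicit Types s t rho : R.

(** The squared modulus of 1 - s cis t, as a polynomial in s. *)
Definition chord_poly t : {poly R} := 1 - (2 * cos t) *: 'X + 'X^2.

(** The Taylor polynomial in s of minus the log of the modulus of 1 - s cis t. *)
Definition log_poly t K : {poly R} :=
  \sum_(k < K) (cos (k.+1%:R * t) / k.+1%:R) *: 'X^(k.+1).

Lemma horner_chord_poly t s : (chord_poly t).[s] = 1 - 2 * cos t * s + s ^+ 2.
Proof. by rewrite /chord_poly !hornerE. Qed.

Lemma cmod_chord t s : cmod (1 - s%:C * cis t) = Num.sqrt (chord_poly t).[s].
Proof.
rewrite horner_chord_poly /cis [X in cmod X](_ : _ = (1 - s * cos t) +i* (- (s * sin t))).
  rewrite /cmod /=; congr Num.sqrt; have := cos2sin2 t.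
  by move: (cos t) (sin t) => x y xy; ring: xy.
by simpc.
Qed.

Lemma chord_poly_ge t s : 0 <= s -> (1 - s) ^+ 2 <= (chord_poly t).[s].
Proof.
move=> s0; rewrite horner_chord_poly -subr_ge0.
rewrite (_ : _ - _ = 2 * s * (1 - cos t)); last by ring.
by rewrite !mulr_ge0// subr_ge0 cos_le1.
Qed.

Lemma deriv_log_poly t K s :
  (log_poly t K)^`().[s] = \sum_(k < K) cos (k.+1%:R * t) * s ^+ k.
Proof.
rewrite /log_poly raddf_sum/= horner_sum; apply: eq_bigr => k _.
rewrite derivZ derivXn hornerZ hornerMn hornerXn /=.
by rewrite -[_ ^+ _ *+ _]mulr_natl mulrA divfK ?pnatr_eq0.
Qed.

(** The real part of a finite geometric sum, cleared of its denominator. *)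
Lemma deriv_log_poly_closed t K s :
  s - cos t + (\sum_(k < K) cos (k.+1%:R * t) * s ^+ k) * (chord_poly t).[s] =
  - s ^+ K * (cos (K.+1%:R * t) - s * cos (K%:R * t)).
Proof.
rewrite horner_chord_poly; elim: K => [|K IH].
  by rewrite big_ord0 !mul0r !mul1r cos0; ring.
rewrite big_ord_recr/= mulrDl addrA IH.
have -> : cos (K.+2%:R * t) = 2 * cos t * cos (K.+1%:R * t) - cos (K%:R * t).
  rewrite (_ : K.+2%:R * t = K.+1%:R * t + t); last by rewrite -(natr1 K.+1); ring.
  rewrite (_ : K%:R * t = K.+1%:R * t - t); last by rewrite -(natr1 K); ring.
  by rewrite cosB cosD; ring.
by rewrite !exprS; ring.
Qed.

Lemma cos_step_le t K s :
  (cos (K.+1%:R * t) - s * cos (K%:R * t)) ^+ 2 <= (chord_poly t).[s].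
Proof.
rewrite horner_chord_poly -(natr1 K) mulrDl mul1r cosD.
have := cos2sin2 t; have := cos2sin2 (K%:R * t).
move: (cos t) (sin t) (cos _) (sin _) => x y u v uv xy.
have -> : 1 - 2 * x * s + s ^+ 2 = (x - s) ^+ 2 + y ^+ 2 by ring: xy.
rewrite -subr_ge0 (_ : _ - _ = ((x - s) * v + y * u) ^+ 2) ?sqr_ge0//.
by ring: uv.
Qed.

(** By the previous identity, the derivative of the error at s is, up to sign, the
    real part of s^K z^(K+1) / (1 - s z) with z = cis t. *)
Lemma log_chord_approx t rho K : 0 <= rho < 1 ->
  `|ln (cmod (1 - rho%:C * cis t)) + (log_poly t K).[rho]| <=
  rho ^+ K.+1 / (1 - rho).
Proof.
move=> /andP[rho0 rho1].
have chord_gt0 s : 0 <= s < 1 -> 0 < (chord_poly t).[s].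
  move=> /andP[s0 s1]; apply: lt_le_trans (chord_poly_ge t s0).
  by rewrite exprn_gt0// subr_gt0.
pose f s := 2^-1 * ln (chord_poly t).[s] + (log_poly t K).[s].
pose df s := 2^-1 * ((chord_poly t).[s]^-1 * (chord_poly t)^`().[s]) +
             (log_poly t K)^`().[s].
have fE s : 0 <= s < 1 ->
    f s = ln (cmod (1 - s%:C * cis t)) + (log_poly t K).[s].
  move=> s01; rewrite cmod_chord /f; congr (_ + _).
  set x := _.[s]; have x0 : 0 < x by exact: chord_gt0.
  rewrite -[x in LHS]sqr_sqrtr ?ltW// expr2 lnM ?posrE ?sqrtr_gt0//.
  by move: (ln _) => l; field.
rewrite -fE ?rho0//.
have f_drv s : 0 <= s < 1 -> is_derive s 1 f (df s).
  move=> s01; apply: is_deriveD.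
  apply: is_deriveZ.
  by have := is_derive1_ln (chord_gt0 s s01) => ?; exact: is_derive1_comp.
have [||c /[!in_itv]/= /andP[c0 crho] e] := @MVT_segment _ f df 0 rho rho0.
- by move=> s /[!in_itv]/= /andP[s0 s1]; apply: f_drv; rewrite ltW// (lt_trans s1).
- apply: derivable_within_continuous => s /[!in_itv]/= /andP[s0 s1].
  by apply: ex_derive; apply: f_drv; rewrite s0 (le_lt_trans s1).
have f0 : f 0 = 0.
  rewrite fE ?lexx ?ltr01// mul0r subr0 cmod1 ln1 add0r /log_poly horner_sum.
  by rewrite big1// => k _; rewrite !hornerE expr0n mulr0.
move: e; rewrite f0 !subr0 => ->.
have c1 : c < 1 by exact: le_lt_trans rho1.
have q0 : 0 < (chord_poly t).[c] by apply: chord_gt0; rewrite c0.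
have dfE : df c = - c ^+ K * (cos (K.+1%:R * t) - c * cos (K%:R * t)) / (chord_poly t).[c].
  rewrite -deriv_log_poly_closed /df deriv_log_poly mulrDl mulfK ?gt_eqF//.
  congr (_ + _); rewrite [X in _ * (_ * X)](_ : _ = 2 * (c - cos t)).
    by move: q0; set q := _.[c] => q0; field; exact: lt0r_neq0.
  rewrite /chord_poly !poly.derivE !hornerE /=.
  ring.
rewrite normrM (ger0_norm rho0) exprS -mulrA mulrC ler_wpM2l//.
rewrite dfE !normrM normrN normfV (ger0_norm (exprn_ge0 _ c0)) (gtr0_norm q0) -mulrA.
apply: ler_pM; rewrite ?exprn_ge0 ?mulr_ge0 ?invr_ge0 ?(ltW q0)//.
  by rewrite lerXn2r ?nnegrE.
set q := _.[c] in q0 *.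
have sq0 : 0 < Num.sqrt q by rewrite sqrtr_gt0.
apply: (@le_trans _ _ (Num.sqrt q)^-1).
  rewrite ler_pdivrMr// [leRHS]mulrC -[X in X / _]sqr_sqrtr ?(ltW q0)// expr2 mulfK ?gt_eqF//.
  by rewrite -sqrtr_sqr ler_wsqrtr// cos_step_le.
rewrite lef_pV2 ?posrE// ?subr_gt0// (@le_trans _ _ (1 - c))//; first by rewrite lerB.
rewrite -[leLHS]ger0_norm ?subr_ge0 ?(ltW c1)// -sqrtr_sqr ler_wsqrtr//.
exact: chord_poly_ge.
Qed.
End LogSeries.

(** * Power sums of zeros on the unit circle *)

Lemma ln_prod (R : realType) (I : eqType) (s : seq I) (F : I -> R) :
  (forall i, i \in s -> 0 < F i) ->
  ln (\prod_(i <- s) F i) = \sum_(i <- s) ln (F i).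
Proof.
elim: s => [|i s IH] F0; first by rewrite !big_nil ln1.
have F0s j : j \in s -> 0 < F j by move=> js; rewrite F0// inE js orbT.
rewrite !big_cons lnM ?IH ?posrE ?F0 ?mem_head//.
by rewrite big_seq prodr_gt0// => j /F0s.
Qed.

Lemma le_of_geometric_error (R : realType) (x y c rho : R) :
  0 <= rho < 1 -> (forall K : nat, x <= y + c * rho ^+ K) -> x <= y.
Proof.
move=> /andP[r0 r1] h.
have /cvg_geometric : `|rho| < 1 by rewrite ger0_norm.
move=> /(_ c) cv; have {}cv : (fun K => y + geometric c rho K) @ \oo --> y + 0.
  by apply: cvgD => //; exact: cvg_cst.
rewrite addr0 in cv; rewrite -(cvg_lim _ cv)//.
by apply: limr_ge; [apply/cvg_ex; exists y|near=> K; exact: h].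
Unshelve. all: by end_near. Qed.

Lemma le_of_radius_lt1 (R : realType) (x y : R) (k : nat) :
  (forall rho, 0 <= rho < 1 -> x * rho ^+ k <= y) -> x <= y.
Proof.
move=> h; have cv : (fun rho : R => x * rho ^+ k) @ (1 : R)^'- --> x * 1 ^+ k.
  apply: cvg_at_left_filter.
  apply: cvgM; first exact: cvg_cst.
  exact: exprn_continuous.
rewrite expr1n mulr1 in cv; rewrite -(cvg_lim _ cv)//.
apply: limr_le; first by apply/cvg_ex; exists x.
near=> rho; apply: h; apply/andP; split; near: rho.
- by exists 1 => //= z; rewrite /ball/= => z1 z2; move: z1; rewrite ltr_distl; lra.
- exact: nbhs_left_lt.
Unshelve. all: by end_near. Qed.

Section PowerSums.
Local Open Scope complex_scope.
Variable R : realType.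

Lemma Re_sum I (r : seq I) (P : pred I) (F : I -> R[i]) :
  complex.Re (\sum_(i <- r | P i) F i) = \sum_(i <- r | P i) complex.Re (F i).
Proof. by apply: (big_morph (@complex.Re R)) => // -[a b] [c e]. Qed.

Lemma sum_cos_grid (M n : nat) (phi : R) : (0 < M)%N -> ~~ (M %| n)%N ->
  \sum_(l < M) cos (n%:R * (2 * pi / M%:R * l%:R) + phi) = 0.
Proof.
move=> M0 Mn; transitivity (complex.Re (\sum_(l < M) (unity_root R M ^+ n) ^+ l * cis phi)).
  rewrite Re_sum; apply: eq_bigr => l _.
  by rewrite -exprM mulnC exprM unity_root_pow -cisMn -cisD.
rewrite -big_distrl/= (unity_root_sum _ (unity_root_prim R M0)) (negbTE Mn).
by rewrite mul0r.
Qed.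

Lemma cos_mul_cos (a b : R) : cos a * cos b = 2^-1 * (cos (a - b) + cos (a + b)).
Proof. by rewrite cosB cosD; field. Qed.

Lemma sum_weighted_cos_grid (M k i : nat) (g t : R) :
  (0 < k)%N -> (0 < i)%N -> (k + i < M)%N ->
  \sum_(l < M) (1 + cos (k%:R * (2 * pi / M%:R * l%:R) + g)) *
      cos (i%:R * (2 * pi / M%:R * l%:R - t)) =
  if i == k then M%:R / 2 * cos (g + k%:R * t) else 0.
Proof.
move=> k0 i0 kiM; have M0 : (0 < M)%N by lia.
have ndvd n : (0 < n < M)%N -> ~~ (M %| n)%N.
  by move=> nM; rewrite gtnNdvd//; case/andP: nM.
pose al (l : 'I_M) : R := 2 * pi / M%:R * l%:R.
rewrite (eq_bigr (fun l => cos (i%:R * al l + - (i%:R * t)) + 2^-1 *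
    (cos (k%:R * al l + g - (i%:R * al l - i%:R * t)) +
     cos ((k + i)%:R * al l + (g - i%:R * t))))); last first.
  move=> l _; rewrite -/(al l) mulrDl mul1r cos_mul_cos mulrBr natrD mulrDl.
  by congr (_ + _ * (_ + cos _)); rewrite addrACA.
rewrite big_split/= (sum_cos_grid _ M0) ?add0r ?ndvd ?i0 ?(leq_ltn_trans _ kiM) ?leq_addl//.
rewrite -big_distrr/= big_split/= (sum_cos_grid _ M0) ?addr0; last first.
  by apply: ndvd; rewrite kiM addn_gt0 k0.
case: eqP => [->|/eqP ik].
  rewrite (eq_bigr (fun=> cos (g + k%:R * t))); last first.
    by move=> l _; congr cos; ring.
  by rewrite sumr_const card_ord -[_ *+ M]mulr_natl mulrA [_^-1 * _]mulrC.
have [le_ki|le_ik] := leqP k i.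
  rewrite (eq_bigr (fun l => cos ((i - k)%:R * al l + (- g - i%:R * t)))); last first.
    by move=> l _; rewrite -cosN natrB//; congr cos; ring.
  rewrite (sum_cos_grid _ M0) ?mulr0//; apply: ndvd.
  by rewrite subn_gt0 ltn_neqAle eq_sym ik le_ki; lia.
rewrite (eq_bigr (fun l => cos ((k - i)%:R * al l + (g + i%:R * t)))); last first.
  by move=> l _; rewrite natrB ?(ltnW le_ik)//; congr cos; ring.
by rewrite (sum_cos_grid _ M0) ?mulr0//; apply: ndvd; lia.
Qed.

(** The weight is nonnegative, so that an upper bound on the log survives the
    averaging, and its only frequencies are 0 and k up to sign: frequency 0
    contributes nothing and frequency k isolates one term of the log series. *)
Lemma weighted_log_chord (M k K : nat) (g t rho : R) :
  (0 < k <= K)%N -> (k + K < M)%N -> 0 <= rho < 1 ->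
  - (rho ^+ k / k%:R / 2 * cos (g + k%:R * t)) - rho ^+ K.+1 / (1 - rho) <=
  M%:R^-1 * \sum_(l < M) (1 + cos (k%:R * (2 * pi / M%:R * l%:R) + g)) *
      ln (cmod (1 - rho%:C * cis (2 * pi / M%:R * l%:R - t))).
Proof.
move=> /andP[k0 kK] kKM rho01; have M0 : (0 < M)%N by lia.
have M0' : 0 < M%:R :> R by rewrite ltr0n.
pose al (l : 'I_M) : R := 2 * pi / M%:R * l%:R.
pose w l := 1 + cos (k%:R * al l + g).
have w_ge0 l : 0 <= w l by rewrite -lerBlDl sub0r cos_geN1.
rewrite -(ler_pM2l M0') mulVKf ?gt_eqF//.
apply: (@le_trans _ _ (\sum_l w l *
    (- (log_poly (al l - t) K).[rho] - rho ^+ K.+1 / (1 - rho)))); last first.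
  apply: ler_sum => l _; apply: ler_wpM2l => //.
  have := log_chord_approx (al l - t) K rho01.
  by rewrite ler_norml -/(al l) => /andP[+ _]; lra.
under eq_bigr do rewrite mulrBr mulrN.
rewrite sumrB -big_distrl/= [X in _ <= _ - X * _](_ : _ = M%:R); last first.
  rewrite big_split/= (sum_cos_grid _ M0) ?addr0 ?sumr_const ?card_ord//.
  by rewrite gtnNdvd//; lia.
rewrite mulrBr lerD2r sumrN mulrN lerN2.
rewrite (eq_bigr (fun l => \sum_(i < K)
    rho ^+ i.+1 / i.+1%:R * (w l * cos (i.+1%:R * (al l - t))))); last first.
  move=> l _; rewrite /log_poly horner_sum big_distrr/=; apply: eq_bigr => i _.
  by rewrite hornerZ hornerXn; ring.
rewrite exchange_big/=.
rewrite (eq_bigr (fun i : 'I_K => rho ^+ i.+1 / i.+1%:R *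
    (if i.+1 == k then M%:R / 2 * cos (g + k%:R * t) else 0))); last first.
  move=> i _; rewrite -big_distrr/= sum_weighted_cos_grid//.
  by have := ltn_ord i; lia.
case: k k0 kK kKM w w_ge0 => // k _ kK kKM w w_ge0.
rewrite (bigD1 (Ordinal kK))//= eqxx big1 ?addr0 => [|i ik]; last first.
  rewrite ifN ?mulr0//; apply: contra ik => /eqP[ik]; exact/eqP/val_inj.
by rewrite le_eqVlt; apply/orP; left; apply/eqP; ring.
Qed.

(** Up to sign and conjugation, the k-th power sum divided by k is a Taylor
    coefficient of the log of the polynomial with these zeros, normalized to equal
    1 at the origin. The real part of this log is at most H in the disk
    and has mean zero, so that testing it against the weight 1 + cos (k x + g)
    bounds the coefficient by 2H. *)
Lemma power_sum_le (th : seq R) (H : R) (k : nat) : (0 < k)%N ->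
  (forall z : R[i], cmod z = 1 -> \prod_(t <- th) cmod (z - cis t) <= expR H) ->
  cmod (\sum_(t <- th) cis (k%:R * t)) <= 2 * k%:R * H.
Proof.
move=> k0 thH; set v := \sum_(t <- th) _.
pose p := \prod_(t <- th) ('X - (cis t)%:P) : {poly R[i]}.
have pE z : cmod p.[z] = \prod_(t <- th) cmod (z - cis t).
  by rewrite horner_prod cmod_prod; apply: eq_bigr => t _; rewrite !hornerE.
have p_le z : cmod z < 1 -> cmod p.[z] <= expR H.
  by apply: maximum_principle => y y1; rewrite pE thH.
(* The phase for which the extracted coefficient is real and negative. *)
have [_ vE] := argP v; pose g := pi - arg v.
have gE : \sum_(t <- th) cos (g + k%:R * t) = - cmod v.
  transitivity (complex.Re (cis g * v)).
    by rewrite /v big_distrr/= Re_sum; apply: eq_bigr => t _; rewrite -cisD.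
  by rewrite [in LHS]vE -/(cis _) mulrCA -cisD subrK /cis cospi sinpi; simpc.
have k0' : 0 < k%:R :> R by rewrite ltr0n.
apply: (@le_of_radius_lt1 _ _ _ k) => rho rho01; case/andP: (rho01) => rho0 rho1.
apply: (@le_of_geometric_error _ _ _
  (2 * k%:R * ((size th)%:R * (rho ^+ k.+1 / (1 - rho)))) rho rho01) => j.
pose K := (k + j)%N; pose M := (k + K).+1.
have M0 : 0 < M%:R :> R by rewrite ltr0n.
pose al (l : 'I_M) : R := 2 * pi / M%:R * l%:R.
pose w l := 1 + cos (k%:R * al l + g).
have w_ge0 l : 0 <= w l by rewrite -lerBlDl sub0r cos_geN1.
have cmod_cis_shift s t : cmod (rho%:C * cis s - cis t) = cmod (1 - rho%:C * cis (s - t)).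
  rewrite cmodB -[LHS]mulr1 -(cmod_cis (- t)) -cmodM mulrBl -cisD subrr cis0.
  by rewrite -mulrA -cisD.
have chord0 s t : 0 < cmod (1 - rho%:C * cis (s - t)).
  rewrite cmod_chord sqrtr_gt0; apply: lt_le_trans (chord_poly_ge _ rho0).
  by rewrite exprn_gt0// subr_gt0.
have logp_le s : \sum_(t <- th) ln (cmod (1 - rho%:C * cis (s - t))) <= H.
  rewrite -ln_prod// -[leRHS]expRK ler_ln ?posrE ?prodr_gt0 ?expR_gt0//.
  under eq_bigr do rewrite -cmod_cis_shift.
  by rewrite -pE p_le// cmodM cmod_cis mulr1 cmod_real ger0_norm.
have : \sum_(t <- th) (- (rho ^+ k / k%:R / 2 * cos (g + k%:R * t))
         - rho ^+ K.+1 / (1 - rho)) <= H.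
  apply: (@le_trans _ _ (\sum_(t <- th) (M%:R^-1 * \sum_(l < M) w l *
      ln (cmod (1 - rho%:C * cis (al l - t)))))).
    apply: ler_sum => t _; apply: weighted_log_chord => //; rewrite ?k0//=.
    by rewrite leq_addr.
  rewrite -big_distrr/= exchange_big/= -(ler_pM2l M0) mulVKf ?gt_eqF//.
  apply: (@le_trans _ _ (\sum_(l < M) w l * H)).
    apply: ler_sum => l _; rewrite -big_distrr/=.
    by apply: ler_wpM2l; [exact: w_ge0|exact: logp_le].
  rewrite -big_distrl/= /w big_split/= (sum_cos_grid _ _) ?addr0 ?sumr_const ?card_ord//.
  by rewrite gtnNdvd// /M ltnS leq_addr.
rewrite sumrB sumrN -big_distrr/= gE big_const_seq count_predT iter_addr addr0.
rewrite mulrN opprK -[_ *+ size th]mulr_natl => le_H.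
have : 2 * k%:R * (rho ^+ k / k%:R / 2 * cmod v -
   (size th)%:R * (rho ^+ K.+1 / (1 - rho))) <= 2 * k%:R * H.
  by rewrite ler_wpM2l// mulr_ge0.
rewrite mulrBr lerBlDr => le_H2.
rewrite (_ : cmod v * _ = 2 * k%:R * (rho ^+ k / k%:R / 2 * cmod v)).
  apply: le_trans le_H2 _; rewrite lerD2l le_eqVlt; apply/orP; left; apply/eqP.
  rewrite /K -addSn exprD; ring.
by field; rewrite gt_eqF.
Qed.
End PowerSums.

(** * Counting points of an arc of the cyclic group *)

Section DiscreteCircle.
Variable R : realType.
Variables (m : nat) (m_gt0 : (0 < m)%N).
Let w : R[i] := unity_root R m.

Lemma unity_root_conj k : conjc (w ^+ k) = w ^+ (m.-1 * k).
Proof.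
rewrite {1}/w unity_root_pow cis_conjV -unity_root_pow -/w.
have wk0 : w ^+ k != 0 by rewrite expf_neq0// cis_neq0.
apply: (mulfI wk0); rewrite divff// -exprD -mulSn prednK//.
by rewrite exprM (prim_expr_order (unity_root_prim R m_gt0)) expr1n.
Qed.

Lemma unity_root_orth (n1 n2 : nat) :
  \sum_(k < m) (w ^+ k) ^+ n1 * (conjc (w ^+ k)) ^+ n2 =
  (if n1 == n2 %[mod m] then m else 0)%:R.
Proof.
rewrite (eq_bigr (fun k : 'I_m => (w ^+ (n1 + m.-1 * n2)) ^+ k)); last first.
  move=> k _.  rewrite unity_root_conj -!exprM -exprD; congr (_ ^+ _).
  by rewrite mulnDl mulnC -!mulnA [(n2 * k)%N]mulnC.
rewrite (unity_root_sum _ (unity_root_prim R m_gt0)).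
have -> : (m %| n1 + m.-1 * n2)%N = (n1 == n2 %[mod m]).
  rewrite /dvdn -[in RHS](modnMDl n2 n1 m) -[X in _ = (_ == X %% m)%N]add0n.
  rewrite (_ : (n2 * m + n1 = n1 + m.-1 * n2 + n2)%N) ?eqn_modDr ?mod0n//.
  by rewrite -addnA -mulSnr prednK// mulnC addnC.
by case: ifP.
Qed.

Lemma unity_root_parseval L : (L <= m)%N ->
  \sum_(k < m) cmod (\sum_(u < L) (w ^+ k) ^+ u) ^+ 2 = (m * L)%:R.
Proof.
move=> Lm; apply: complexI; rewrite rmorph_sum/= rmorph_nat.
rewrite (eq_bigr (fun k : 'I_m => \sum_(u < L) \sum_(v < L)
    (w ^+ k) ^+ u * (conjc (w ^+ k)) ^+ v)); last first.
  move=> k _; rewrite rmorphXn/= -norm_cmod sqr_normc sum_conj big_distrl/=.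
  apply: eq_bigr => u _; rewrite big_distrr/=; apply: eq_bigr => v _.
  by rewrite rmorphXn.
rewrite exchange_big/= (eq_bigr (fun=> m%:R)); last first.
  move=> u _; rewrite exchange_big/= (bigD1 u)//= unity_root_orth eqxx.
  rewrite big1 ?addr0// => v vu; rewrite unity_root_orth ifN//.
  rewrite !modn_small ?(leq_trans (ltn_ord _) Lm)//.
  by apply: contra vu => /eqP e; apply/eqP/val_inj.
by rewrite sumr_const card_ord -mulrnA.
Qed.

(** A majorant of the indicator of an arc of Z/m is the indicator of a longer arc
    convolved with two boxes of length L. Its mean is the main term; the other
    frequencies are controlled by the hypothesis and Parseval. *)
Lemma discrete_count_le (L A s : nat) (xs : seq nat) (E : R) :
  (0 < L <= m)%N -> 0 <= E ->
  (forall k, (0 < k < m)%N ->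
    cmod (\sum_(x <- xs) (w ^+ k) ^+ x) *
    cmod (\sum_(y < s + L * 2) (w ^+ k) ^+ y) <= E) ->
  (count (fun x => A <= x < A + s)%N xs)%:R <=
  (size xs)%:R * (s + L * 2)%:R / m%:R + E / L%:R.
Proof.
move=> /andP[L0 Lm] E0 hE; set S := (s + L * 2)%N in hE *.
have m0' : 0 < m%:R :> R by rewrite ltr0n.
have L0' : 0 < L%:R :> R by rewrite ltr0n.
pose P k := \sum_(x <- xs) (w ^+ k) ^+ x.
pose B k := \sum_(u < L) (w ^+ k) ^+ u.
pose J k := \sum_(y < S) (conjc (w ^+ k)) ^+ (A + y).
(* The sum of the majorant over the points, normalized to be an integer. *)
pose c := (\sum_(x <- xs) \sum_(u < L) \sum_(v < L) \sum_(y < S)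
  (if x + u + v == A + y %[mod m] then m else 0))%N.
have cE : c%:R = \sum_(k < m) P k * B k ^+ 2 * J k.
  rewrite /c natr_sum (eq_bigr (fun x => \sum_(k < m) (w ^+ k) ^+ x * B k ^+ 2 * J k)).
    by rewrite exchange_big/=; apply: eq_bigr => k _; rewrite -!big_distrl.
  move=> x _; rewrite natr_sum.
  transitivity (\sum_(u < L) \sum_(k < m) (w ^+ k) ^+ x * (w ^+ k) ^+ u * B k * J k).
    apply: eq_bigr => u _; rewrite natr_sum.
    transitivity (\sum_(v < L) \sum_(k < m)
        (w ^+ k) ^+ x * (w ^+ k) ^+ u * (w ^+ k) ^+ v * J k).
      apply: eq_bigr => v _; rewrite natr_sum.
      transitivity (\sum_(y < S) \sum_(k < m)
          (w ^+ k) ^+ (x + u + v) * (conjc (w ^+ k)) ^+ (A + y)).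
        by apply: eq_bigr => y _; rewrite unity_root_orth.
      rewrite exchange_big/=; apply: eq_bigr => k _.
      by rewrite -big_distrr/= !exprD.
    rewrite exchange_big/=; apply: eq_bigr => k _.
    by rewrite -big_distrl -big_distrr.
  rewrite exchange_big/=; apply: eq_bigr => k _.
  by rewrite -!big_distrl/= -big_distrr/= expr2 mulrA.
have cL : (count (fun x => A <= x < A + s)%N xs * (L * L * m) <= c)%N.
  rewrite /c -sum1_count big_distrl/= big_mkcond/=; apply: leq_sum => x _.
  case: ifP => // /andP[Ax xs']; rewrite mul1n.
  have -> : (L * L * m = \sum_(u < L) \sum_(v < L) m)%N.
    by rewrite !sum_nat_const !card_ord mulnA.
  apply: leq_sum => u _; apply: leq_sum => v _.
  have yS : (x + u + v - A < S)%N.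
    by rewrite /S; have := ltn_ord u; have := ltn_ord v; lia.
  rewrite (bigD1 (Ordinal yS))//= subnKC ?eqxx ?leq_addr//.
  by rewrite -addnA (leq_trans Ax)// leq_addr.
have JE k : cmod (J k) = cmod (\sum_(y < S) (w ^+ k) ^+ y).
  rewrite /J; under eq_bigr do rewrite exprD.
  rewrite -big_distrr/= cmodM cmodX cmod_conj unity_root_norm expr1n mul1r.
  rewrite -[RHS]cmod_conj sum_conj; congr cmod; apply: eq_bigr => y _.
  exact/esym/rmorphXn.
have P0 : cmod (P 0%N) = (size xs)%:R.
  rewrite /P; under eq_bigr do rewrite expr0 expr1n.
  by rewrite big_const_seq count_predT iter_addr addr0 cmod_nat.
have B0 : cmod (B 0%N) = L%:R.
  by rewrite /B; under eq_bigr do rewrite expr0 expr1n; rewrite sumr_const card_ord cmod_nat.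
have J0 : cmod (J 0%N) = S%:R.
  rewrite JE; under eq_bigr do rewrite expr0 expr1n.
  by rewrite sumr_const card_ord cmod_nat.
have termE k : cmod (P k * B k ^+ 2 * J k) = cmod (P k) * cmod (B k) ^+ 2 * cmod (J k).
  by rewrite 2!cmodM cmodX.
have c_le : c%:R <= (size xs)%:R * L%:R ^+ 2 * S%:R + E * (m * L)%:R.
  rewrite -[c%:R]cmod_nat cE (le_trans (le_cmod_sum _ _ _))//.
  rewrite (bigD1 (Ordinal m_gt0))//= termE P0 B0 J0 lerD2l.
  rewrite -(unity_root_parseval Lm) [in leRHS](bigD1 (Ordinal m_gt0))//= mulrDr.
  rewrite -[leLHS]add0r lerD//; first by rewrite mulr_ge0 ?sqr_ge0.
  rewrite big_distrr/=; apply: ler_sum => k k0.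
  rewrite termE mulrAC; apply: ler_wpM2r; first by rewrite exprn_ge0 ?cmod_ge0.
  rewrite JE hE// ltn_ord andbT lt0n; apply: contra k0 => /eqP k0.
  by apply/eqP/val_inj.
have LLm : 0 < (L * L * m)%:R :> R by rewrite ltr0n !muln_gt0 L0.
rewrite -(ler_pM2r LLm) -[leLHS]natrM.
apply: (@le_trans _ _ c%:R); first by rewrite ler_nat.
apply: le_trans c_le _; rewrite le_eqVlt; apply/orP; left; apply/eqP.
rewrite !natrM; field; rewrite !gt_eqF//.
Qed.
End DiscreteCircle.

(** * Counting angles in an arc of the circle *)

Section ArcDiscrepancy.
Local Open Scope complex_scope.
Variable R : realType.

Lemma cmod_geometric_le (q : R[i]) S : cmod q = 1 ->
  cmod (1 - q) * cmod (\sum_(y < S) q ^+ y) <= 2.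
Proof.
move=> q1; rewrite cmodB -cmodM -subrX1 (le_trans (le_cmodD _ _))//.
by rewrite cmodN cmod1 cmodX q1 expr1n.
Qed.

Lemma unity_root_conj_sub m k : (0 < m)%N -> (k <= m)%N ->
  conjc (unity_root R m ^+ k) = unity_root R m ^+ (m - k).
Proof.
move=> m0 km; rewrite unity_root_pow cis_conjV -unity_root_pow.
have wk0 : unity_root R m ^+ k != 0 by rewrite expf_neq0// cis_neq0.
apply: (mulfI wk0); rewrite divff// -exprD subnKC//.
by rewrite (prim_expr_order (unity_root_prim R m0)).
Qed.

Definition grid_index m (t : R) : nat := Num.trunc (m%:R * t / (2 * pi)).

Lemma grid_index_itv m t : 0 <= t ->
  (grid_index m t)%:R <= m%:R * t / (2 * pi) < (grid_index m t).+1%:R.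
Proof.
move=> t0; apply: truncn_itv.
by rewrite divr_ge0 ?mulr_ge0 ?pi_ge0.
Qed.

Section Rounding.
Variables (th : seq R) (H : R) (m : nat).
Hypothesis m_gt0 : (0 < m)%N.
Hypothesis th_ge0 : forall t, t \in th -> 0 <= t.
Hypothesis H_ge0 : 0 <= H.
Hypothesis th_psum : forall k, (0 < k)%N ->
  cmod (\sum_(t <- th) cis (k%:R * t)) <= 2 * k%:R * H.
Let xs := map (grid_index m) th.
Let w := unity_root R m.

(** Rounding moves each angle by at most 2 pi / m, hence each k-th power by at most
    2 pi k / m. *)
Lemma grid_power_sum_le k : (0 < k)%N ->
  cmod (\sum_(x <- xs) (w ^+ k) ^+ x) <=
  2 * k%:R * (H + pi * (size th)%:R / m%:R).
Proof.
move=> k0; have m0 : 0 < m%:R :> R by rewrite ltr0n.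
have pi0 := @pi_gt0 R.
rewrite /xs big_map -[X in cmod X](subrK (\sum_(t <- th) cis (k%:R * t))).
rewrite (le_trans (le_cmodD _ _))// addrC [leRHS]mulrDr lerD ?th_psum//.
rewrite -sumrB (le_trans (le_cmod_sum _ _ _))//.
apply: (@le_trans _ _ (\sum_(t <- th) (2 * k%:R * (pi / m%:R)))); last first.
  rewrite big_const_seq count_predT iter_addr addr0 -[_ *+ size th]mulr_natl.
  by rewrite le_eqVlt; apply/orP; left; apply/eqP; move: (pi : R) => p; ring.
rewrite big_seq [leRHS]big_seq; apply: ler_sum => t /th_ge0 t0.
rewrite -exprM unity_root_pow (le_trans (cmod_cisB _ _))//.
have /andP[x1 x2] := grid_index_itv m t0; set x := grid_index m t in x1 x2 *.
have -> : 2 * pi / m%:R * (k * x)%:R - k%:R * t =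
    - (2 * k%:R * (pi / m%:R) * (m%:R * t / (2 * pi) - x%:R)).
  by rewrite natrM; move: (pi : R) pi0 => p p0; field; rewrite !gt_eqF.
rewrite normrN normrM ger0_norm; last by rewrite !mulr_ge0 ?invr_ge0// ltW.
rewrite ler_piMr//; first by rewrite !mulr_ge0 ?invr_ge0// ltW.
by rewrite ger0_norm ?subr_ge0// lerBlDl natr1 ltW.
Qed.

(** Conjugation exchanges the frequencies k and m - k, so that k <= m / 2 can be
    assumed; then the bounds 2 k (H + ...) on the power sum and m / (2 k) on the
    geometric sum multiply to a bound independent of k. *)
Lemma grid_frequency_le S k : (0 < k < m)%N ->
  cmod (\sum_(x <- xs) (w ^+ k) ^+ x) * cmod (\sum_(y < S) (w ^+ k) ^+ y) <=
  m%:R * H + pi * (size th)%:R.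
Proof.
have m0 : 0 < m%:R :> R by rewrite ltr0n.
have low j : (0 < j)%N -> (2 * j <= m)%N ->
    cmod (\sum_(x <- xs) (w ^+ j) ^+ x) * cmod (\sum_(y < S) (w ^+ j) ^+ y) <=
    m%:R * H + pi * (size th)%:R.
  move=> j0 jm; have j0' : 0 < j%:R :> R by rewrite ltr0n.
  have c0 : 0 < 4 * j%:R / m%:R :> R by rewrite divr_gt0 ?mulr_gt0.
  have := cmod_geometric_le S (unity_root_norm R m j); rewrite -/w => g_le.
  have : 4 * j%:R / m%:R * cmod (\sum_(y < S) (w ^+ j) ^+ y) <= 2.
    apply: le_trans g_le; apply: ler_wpM2r; first exact: cmod_ge0.
    by rewrite /w unity_root_pow chord_ge.
  rewrite mulrC -ler_pdivlMr// => g_le2.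
  apply: le_trans (ler_pM _ _ (grid_power_sum_le j0) g_le2) _; rewrite ?cmod_ge0//.
  rewrite le_eqVlt; apply/orP; left; apply/eqP.
  by move: (pi : R) => p; field; rewrite !gt_eqF.
move=> /andP[k0 km]; have [|mk] := leqP (2 * k) m; first exact: low.
have cj z0 (r : seq nat) : cmod (\sum_(x <- r) z0 ^+ x) = cmod (\sum_(x <- r) (conjc z0) ^+ x) :> R.
  rewrite -cmod_conj sum_conj; congr cmod; apply: eq_bigr => x _; exact: rmorphXn.
rewrite (cj _ xs) -(big_mkord xpredT (fun y => (w ^+ k) ^+ y)) (cj _ (index_iota 0 S)) big_mkord.
rewrite unity_root_conj_sub// ?(ltnW km)//; apply: low; first by rewrite subn_gt0.
lia.
Qed.

Lemma grid_arc_count_le (a b t : R) : 0 <= a <= b -> 0 < t < 1 ->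
  (count (fun x => a <= x < b) th)%:R <=
  (size th)%:R * ((b - a) / (2 * pi) + 2 * t) + H / t +
  (4 + pi / t) * (size th)%:R / m%:R.
Proof.
move=> /andP[a0 ab] /andP[t0 t1]; have m0 : 0 < m%:R :> R by rewrite ltr0n.
have pi0 := @pi_gt0 R; have b0 := le_trans a0 ab.
pose L := (Num.trunc (t * m%:R)).+1.
have tm0 : 0 <= t * m%:R by rewrite mulr_ge0 ?ltW.
have /andP[L1 L2] := truncn_itv tm0.
have Lm : (L <= m)%N.
  rewrite /L -(ltr_nat R) (le_lt_trans L1)// gtr_pMl//.
have L0 : 0 < L%:R :> R by rewrite ltr0n.
pose A := grid_index m a; pose s := ((grid_index m b).+1 - A)%N.
have /andP[A1 A2] := grid_index_itv m a0.
have /andP[B1 B2] := grid_index_itv m b0.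
have mono u v : u <= v -> (grid_index m u <= grid_index m v)%N.
  move=> uv; apply: le_truncn; rewrite ler_wpM2r ?invr_ge0 ?mulr_ge0 ?(ltW pi0)//.
  by rewrite ler_wpM2l// ltW.
have AB := mono _ _ ab.
have As : (A + s = (grid_index m b).+1)%N by rewrite subnKC// (leq_trans AB).
have s_le : s%:R <= m%:R * ((b - a) / (2 * pi)) + 2 :> R.
  have -> : s%:R = (grid_index m b)%:R - A%:R + 1 :> R.
    by rewrite /s subSn// -natr1 natrB.
  have -> : m%:R * ((b - a) / (2 * pi)) = m%:R * b / (2 * pi) - m%:R * a / (2 * pi).
    by rewrite mulrA mulrBr mulrBl.
  by move: A2 B1; rewrite -natr1 -/A; lra.
pose E := m%:R * H + pi * (size th)%:R.
have E0 : 0 <= E by rewrite addr_ge0 ?mulr_ge0// ltW.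
have := @discrete_count_le R m m_gt0 L A s xs E _ E0
  (fun k hk => @grid_frequency_le _ k hk).
rewrite Lm => /(_ isT); rewrite size_map => h.
apply: (@le_trans _ _ (count (fun x => A <= x < A + s)%N xs)%:R).
  rewrite ler_nat count_map; apply: sub_count => x /= /andP[ax xb].
  by rewrite As ltnS !mono// ltW.
apply: le_trans h _.
have -> : (size th)%:R * ((b - a) / (2 * pi) + 2 * t) + H / t +
    (4 + pi / t) * (size th)%:R / m%:R =
    (size th)%:R * (m%:R * ((b - a) / (2 * pi)) + 2 + (t * m%:R + 1) * 2) / m%:R +
    E / (t * m%:R).
  rewrite /E; set q := (b - a) / _; move: (pi : R) => p.
  by field; rewrite !gt_eqF.
apply: lerD.
  rewrite ler_pM2r ?invr_gt0// ler_wpM2l// natrD natrM lerD//.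
  by rewrite ler_wpM2r// /L -natr1 lerD2r.
by rewrite ler_wpM2l// lef_pV2 ?posrE ?mulr_gt0// ltW.
Qed.
End Rounding.

(** The cost of rounding the angles to a grid of mesh 2 pi / m vanishes as m grows.
    The parameter t is half the total widening of the arc by the smoothing, as a
    fraction of the circle, and is left free: a wide kernel has a large mean and
    small high frequencies. *)
Lemma arc_count_le (th : seq R) (H a b t : R) :
  (forall x, x \in th -> 0 <= x) -> 0 <= H ->
  (forall k, (0 < k)%N -> cmod (\sum_(x <- th) cis (k%:R * x)) <= 2 * k%:R * H) ->
  0 <= a <= b -> 0 < t ->
  (count (fun x => a <= x < b) th)%:R <=
  (size th)%:R * ((b - a) / (2 * pi) + 2 * t) + H / t.
Proof.
move=> th0 H0 psum ab t0; have pi0 := @pi_gt0 R.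
have [t1|t1] := ltP t 1; last first.
  apply: (@le_trans _ _ (size th)%:R); first by rewrite ler_nat count_size.
  rewrite -[leLHS]addr0 lerD ?divr_ge0 ?(ltW t0)// ler_peMr//.
  have : 0 <= (b - a) / (2 * pi).
    by rewrite divr_ge0 ?mulr_ge0 ?subr_ge0 ?(ltW pi0)//; case/andP: ab.
  lra.
pose c := (4 + pi / t) * (size th)%:R.
have c0 : 0 <= c by rewrite mulr_ge0// addr_ge0// divr_ge0 ?ltW.
apply/ler_addgt0Pr => e e0; pose m := (Num.bound (c / e)).+1.
have m0 : (0 < m)%N by [].
apply: le_trans (@grid_arc_count_le th H m m0 th0 H0 psum a b t ab _) _.
  by rewrite t0.
rewrite lerD2l -/c ler_pdivrMr ?ltr0n// mulrC -ler_pdivrMr//.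
have := archi_boundP (divr_ge0 c0 (ltW e0)) => /ltW h; apply: le_trans h _.
by rewrite ler_nat.
Qed.
End ArcDiscrepancy.

(** * Projection of the zeros to the unit circle and angular sectors *)

Section SectorDiscrepancy.
Local Open Scope complex_scope.
Variable R : realType.

(** With rho the modulus of w and u = cis (arg w),
    |z - rho u|^2 - rho |z - u|^2 = (1 - rho)^2 on the unit circle. *)
Lemma radial_projection_le (z w : R[i]) : cmod z = 1 -> w != 0 ->
  cmod (z - cis (arg w)) <= cmod (z - w) * expR (- (ln (cmod w) / 2)).
Proof.
rewrite -cmod_gt0 => z1 w0; set rho := cmod w in w0 *.
rewrite -(@ler_pXn2r _ 2) ?nnegrE ?cmod_ge0 ?mulr_ge0 ?cmod_ge0 ?expR_ge0//.
rewrite exprMn -expRM_natl mulrN [2%:R * _]mulrC divfK//.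
rewrite expRN lnK ?posrE// ler_pdivlMr//.
have [_ wE] := argP w; rewrite {2}wE -/rho.
have := cos2sin2 (arg w); rewrite /cis; move: (cos _) (sin _) => c s cs.
case: z z1 => x y xy; have := cmod_sqr x y; rewrite xy expr1n => {}xy.
have -> : x +i* y - (c +i* s) = (x - c) +i* (y - s) by simpc.
have -> : x +i* y - rho%:C * (c +i* s) = (x - rho * c) +i* (y - rho * s) by simpc.
rewrite !cmod_sqr -subr_ge0 (_ : _ - _ = (1 - rho) ^+ 2) ?sqr_ge0//.
have {}xy : x ^+ 2 = 1 - y ^+ 2 by rewrite xy addrK.
by ring: xy cs.
Qed.

Variables (c : R[i]) (zs : seq R[i]) (S : R).
Hypothesis c_neq0 : c != 0.
Hypothesis zs_neq0 : forall z, z \in zs -> z != 0.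
Hypothesis S_gt0 : 0 < S.
Hypothesis circle_le : forall z, cmod z = 1 ->
  cmod c * \prod_(w <- zs) cmod (z - w) <= S.

(** For the polynomial with leading coefficient c and zeros zs, this is
    log (S / sqrt |a_0 a_n|). *)
Definition log_excess : R :=
  ln S - ln (cmod c) - (\sum_(w <- zs) ln (cmod w)) / 2.

Lemma projected_zeros_le z : cmod z = 1 ->
  \prod_(t <- map (@arg R) zs) cmod (z - cis t) <= expR log_excess.
Proof.
move=> z1; have c0 : 0 < cmod c by rewrite cmod_gt0.
have circ : \prod_(w <- zs) cmod (z - w) <= S / cmod c.
  by rewrite ler_pdivlMr// mulrC circle_le.
rewrite /log_excess !expRD expRN !lnK ?posrE//.
rewrite big_distrl/= -sumrN expR_sum.
apply: (@le_trans _ _ ((\prod_(w <- zs) cmod (z - w)) *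
    \prod_(w <- zs) expR (- (ln (cmod w) / 2)))); last first.
  by rewrite ler_wpM2r// prodr_ge0// => w _; exact: expR_ge0.
rewrite -big_split/= big_map big_seq [leRHS]big_seq.
apply: ler_prod => w /zs_neq0 w0; rewrite cmod_ge0/=.
exact: radial_projection_le.
Qed.

Let th := map (@arg R) zs.

Lemma projected_power_sum_le k : (0 < k)%N ->
  cmod (\sum_(t <- th) cis (k%:R * t)) <= 2 * k%:R * log_excess.
Proof. by move=> k0; apply: power_sum_le => // z; exact: projected_zeros_le. Qed.

Lemma log_excess_ge0 : 0 <= log_excess.
Proof.
have /(le_trans (cmod_ge0 _)) := @projected_power_sum_le 1%N isT.
by rewrite mulr1 pmulr_rge0.
Qed.

Lemma sector_count_le (a b t : R) : 0 <= a <= b -> 0 < t ->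
  (count (fun z => a <= arg z < b) zs)%:R <=
  (size zs)%:R * ((b - a) / (2 * pi) + 2 * t) + log_excess / t.
Proof.
move=> ab t0; have := @arc_count_le R th log_excess a b t _ log_excess_ge0
  projected_power_sum_le ab t0.
rewrite /th count_map size_map; apply=> x /mapP[z _ ->].
by have [/andP[]] := argP z.
Qed.

(** The lower bound is the upper bound for the complementary arc [b, a + 2 pi),
    on which the angles below a reappear shifted by 2 pi. *)
Lemma sector_count_ge (a b t : R) : 0 <= a <= b -> b <= 2 * pi -> 0 < t ->
  (size zs)%:R * ((b - a) / (2 * pi) - 2 * t) - log_excess / t <=
  (count (fun z => a <= arg z < b) zs)%:R.
Proof.
move=> /andP[a0 ab] b2 t0; have pi0 := @pi_gt0 R.
pose wrap (x : R) : R := if x < a then x + 2 * pi else x.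
have cis_wrap k x : cis (k%:R * wrap x) = cis (k%:R * x).
  rewrite /wrap; case: ifP => // _.
  by rewrite mulrDr cisD [X in _ * X]cisMn cis2pi expr1n mulr1.
have := @arc_count_le R (map wrap th) log_excess b (a + 2 * pi) t _ log_excess_ge0 _ _ t0.
have wrap_ge0 x : x \in map wrap th -> 0 <= x.
  case/mapP => _ /mapP[z _ ->] ->; have [/andP[z0 _] _] := argP z.
  by rewrite /wrap; case: ifP => // _; rewrite addr_ge0// mulr_ge0// ltW.
move=> /(_ wrap_ge0) h.
have {h} : (count (fun x => b <= x < a + 2 * pi) (map wrap th))%:R <=
    (size (map wrap th))%:R * ((a + 2 * pi - b) / (2 * pi) + 2 * t) + log_excess / t.
  apply: h.
    by move=> k k0; rewrite big_map; under eq_bigr do rewrite cis_wrap;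
       exact: projected_power_sum_le.
  by rewrite (le_trans a0 ab)/=; lra.
rewrite !size_map !count_map => h.
pose inside (z : R[i]) := a <= arg z < b; rewrite -/inside.
pose wrapped (z : R[i]) := b <= wrap (arg z) < a + 2 * pi.
have hsub : (count (predC inside) zs <= count wrapped zs)%N.
  apply: sub_count => z; rewrite /wrapped /inside /=; have [/andP[z0 z2] _] := argP z.
  rewrite /wrap; case: (ltP (arg z) a) => za /= zb.
    by rewrite (le_trans b2) ?lerDr//= ltrD2r.
  by rewrite leNgt zb/= (lt_le_trans z2)// lerDr.
have hsize : (size zs)%:R = (count inside zs)%:R + (count (predC inside) zs)%:R :> R.
  by rewrite -natrD count_predC.
move: hsub; rewrite -(ler_nat R) => /le_trans/(_ h).
have -> : (a + 2 * pi - b) / (2 * pi) = 1 - (b - a) / (2 * pi).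
  by move: (pi : R) pi0 => p p0; field; rewrite gt_eqF.
move: hsize; set q := _ / (2 * pi); set u := log_excess / t.
move: (_%:R) => n; lra.
Qed.
End SectorDiscrepancy.

(** * Zeros outside the annulus *)

Section AnnulusCount.
Local Open Scope complex_scope.
Variable R : realType.
Variables (c : R[i]) (zs : seq R[i]) (S : R).
Hypothesis c_neq0 : c != 0.
Hypothesis zs_neq0 : forall z, z \in zs -> z != 0.
Hypothesis circle_le : forall z, cmod z = 1 ->
  cmod c * \prod_(w <- zs) cmod (z - w) <= S.

(** Reflecting the zeros outside the disk in the unit circle does not change the
    modulus on the circle and makes the product the leading coefficient. *)
Lemma mahler_measure_le : cmod c * \prod_(w <- zs) Num.max 1 (cmod w) <= S.
Proof.
pose fl (w : R[i]) : {poly R[i]} :=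
  if cmod w <= 1 then 'X - w%:P else 1 - conjc w *: 'X.
have fl_circle z w : cmod z = 1 -> cmod (fl w).[z] = cmod (z - w).
  move=> z1; rewrite /fl; case: ifP => _; first by rewrite !hornerE.
  rewrite !hornerE -[RHS]cmod_conj rmorphB/= -[RHS]mul1r -[X in _ = X * _]z1 -cmodM mulrBr.
  by rewrite -sqr_normc norm_cmod z1 expr1n mulrC.
have fl_lead w : cmod (lead_coef (fl w)) = Num.max 1 (cmod w).
  rewrite /fl; case: leP => w1.
    by rewrite lead_coefXsubC cmod1.
  have w0 : conjc w != 0 by rewrite -cmod_gt0 cmod_conj (lt_trans _ w1).
  rewrite addrC lead_coefDl ?lead_coefN ?lead_coefZ ?lead_coefX ?mulr1.
    by rewrite cmodN cmod_conj.
  by rewrite size_polyN size_scale// size_polyX size_poly1.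
pose q := c *: \prod_(w <- zs) fl w.
have -> : cmod c * \prod_(w <- zs) Num.max 1 (cmod w) = cmod (lead_coef q).
  rewrite lead_coefZ cmodM lead_coef_prod cmod_prod; congr (_ * _).
  by apply: eq_bigr => w _; rewrite fl_lead.
apply: coef_le_circle => z z1.
rewrite hornerZ cmodM horner_prod cmod_prod.
under eq_bigr do rewrite fl_circle//.
exact: circle_le.
Qed.

(** Uses |log x| = 2 log max(1, x) - log x, where the sum of the first terms is the
    log of the Mahler measure. *)
Lemma sum_abs_ln_le :
  \sum_(w <- zs) `|ln (cmod w)| <= 2 * log_excess c zs S.
Proof.
have c0 : 0 < cmod c by rewrite cmod_gt0.
have m_gt0 (w : R[i]) : 0 < Num.max 1 (cmod w) by rewrite lt_max ltr01.
have S0 : 0 < S by apply: lt_le_trans mahler_measure_le; rewrite mulr_gt0 ?prodr_gt0.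
have := mahler_measure_le; rewrite -ler_ln ?posrE ?mulr_gt0 ?prodr_gt0//.
rewrite lnM ?posrE ?prodr_gt0// ln_prod// => h.
have -> : \sum_(w <- zs) `|ln (cmod w)| =
    2 * (\sum_(w <- zs) ln (Num.max 1 (cmod w))) - \sum_(w <- zs) ln (cmod w).
  rewrite big_distrr/= -sumrB big_seq [RHS]big_seq; apply: eq_bigr => w /zs_neq0.
  rewrite -cmod_gt0 => w0; have [w1|w1] := leP (cmod w) 1.
    by rewrite ln1 mulr0 sub0r ler0_norm// ln_le0.
  by rewrite ger0_norm ?ln_ge0 ?ltW//; ring.
rewrite /log_excess; move: h; lra.
Qed.

Lemma outside_annulus_count_le (r : R) : 0 < r < 1 ->
  (count (fun z => ~~ (r < cmod z < r^-1)) zs)%:R * (1 - r) <=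
  2 * log_excess c zs S.
Proof.
move=> /andP[r0 r1]; apply: le_trans sum_abs_ln_le.
rewrite -sum1_count natr_sum big_distrl/= big_mkcond/= big_seq [leRHS]big_seq.
apply: ler_sum => w /zs_neq0; rewrite -cmod_gt0 => w0.
have lnr : ln r <= r - 1.
  have := @le_ln1Dx R (r - 1); rewrite addrCA subrr addr0; apply.
  by rewrite ltrBrDr addrC subrr.
case: ifP => // /nandP[]; rewrite -leNgt mul1r => wr.
  have : ln (cmod w) <= ln r by rewrite ler_ln ?posrE.
  by rewrite -normrN => h; apply: le_trans (ler_norm _); lra.
have : ln r^-1 <= ln (cmod w) by rewrite ler_ln ?posrE ?invr_gt0.
by rewrite lnV ?posrE// => h; apply: le_trans (ler_norm _); lra.
Qed.
End AnnulusCount.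

(** * Bounds on the constants *)

Section Catalan.
Variable R : realType.

Let u (k : nat) : R := ((2 * k + 1)%N%:R ^+ 2)^-1.

Let u_ge0 k : 0 <= u k. Proof. by rewrite invr_ge0 sqr_ge0. Qed.

Let u_noninc k : u k.+1 <= u k.
Proof.
rewrite lef_pV2 ?posrE ?exprn_gt0 ?ltr0n ?addn1//.
by rewrite lerXn2r ?nnegrE// ler_nat; lia.
Qed.

Lemma is_cvg_catalan_series :
  cvgn (series (fun k => (-1) ^+ k / (2 * k + 1)%N%:R ^+ 2 : R)).
Proof.
apply: normed_cvg.
rewrite [X in cvgn (series X)](_ : _ = u); last first.
  apply/funext => k /=; rewrite normrM normrX normrN1 expr1n mul1r.
  by rewrite ger0_norm// u_ge0.
apply: nondecreasing_is_cvgn; first exact/nondecreasing_series.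
exists 2 => _ [n _ <-]; rewrite seriesEnat/=.
case: n => [|n]; first by rewrite big_geq.
(* Comparison with the telescoping series of 1/n - 1/(n+1). *)
apply: (@le_trans _ _ (2 - n.+1%:R^-1)); last by rewrite gerBl.
elim: n => [|n IH]; first by rewrite big_nat1 /u muln0 add0n expr1n !invr1; lra.
rewrite big_nat_recr//= (le_trans (lerD IH (lexx _)))//.
have n1 : 0 < n.+1%:R :> R by rewrite ltr0n.
have n2 : 0 < n.+2%:R :> R by rewrite ltr0n.
suff : u n.+1 <= n.+1%:R^-1 - n.+2%:R^-1.
  by move: (u _) n.+1%:R^-1 n.+2%:R^-1 => x y z; lra.
have -> : n.+1%:R^-1 - n.+2%:R^-1 = (n.+1%:R * n.+2%:R)^-1 :> R.
  move: n1 n2; rewrite -(natr1 n.+1); move: n.+1%:R => x x0 x1.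
  by field; rewrite !gt_eqF.
rewrite lef_pV2 ?posrE ?exprn_gt0 ?mulr_gt0 ?ltr0n ?addn1//.
by rewrite -natrX -natrM ler_nat; nia.
Qed.

(** The terms decrease and alternate in sign, so the partial sums stay between the
    first two of them. *)
Lemma catalan_series_bounds n :
  8 / 9 <= series (fun k => (-1) ^+ k / (2 * k + 1)%N%:R ^+ 2 : R) n.+1 <= 1.
Proof.
set s := series _.
have sS k : s k.+1 = s k + (-1) ^+ odd k * u k by rewrite /s seriesSr signr_odd.
suff : if odd n then 8 / 9 <= s n.+1 /\ s n.+1 + u n.+1 <= 1
       else s n.+1 <= 1 /\ 8 / 9 <= s n.+1 - u n.+1.
  have := u_ge0 n.+1; case: odd => u0 [h1 h2]; apply/andP; split; lra.
elim: n => [|n IH] /=.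
  rewrite sS [s 0%N](_ : _ = 0); last by rewrite /s seriesEnat/= big_geq.
  rewrite add0r mul1r /u muln0 add0n expr1n invr1; split => //.
  have -> : ((2 * 1 + 1)%N%:R ^+ 2)^-1 = 1 / 9 :> R by rewrite muln1 -natrX div1r.
  by lra.
have := u_noninc n.+1; have := u_noninc n; rewrite sS/=.
by move: IH; case: odd => /= -[h1 h2] h3 h4; split; lra.
Qed.

Lemma catalan_bounds : 8 / 9 <= catalan R <= 1.
Proof.
rewrite /catalan; have cv := is_cvg_catalan_series; apply/andP; split.
  apply: limr_ge => //; near=> n.
  have n0 : (0 < n)%N by near: n; exact: nbhs_infty_gt.
  by rewrite -(prednK n0); have /andP[] := catalan_series_bounds n.-1.
apply: limr_le => //; near=> n.
have n0 : (0 < n)%N by near: n; exact: nbhs_infty_gt.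
by rewrite -(prednK n0); have /andP[] := catalan_series_bounds n.-1.
Unshelve. all: by end_near. Qed.

Lemma sector_constant_ge (r : R) : 2 + 2 / (1 - r) <= sector_constant r.
Proof.
have /andP[k0 k1] := catalan_bounds; have {}k0 : 0 < catalan R by lra.
rewrite lerD2r -[leLHS]ger0_norm// -sqrtr_sqr ler_wsqrtr//.
rewrite ler_pdivlMr// expr2 -mulrA ler_pM2l//.
have := pi_ge2 R; move: (pi : R) => p; lra.
Qed.
End Catalan.

(** * Zeros of a polynomial in an annular sector *)

Section ZeroDistribution.
Variable R : realType.
Implicit Types p : {poly R[i]}.

Lemma zeros_factor p : p = lead_coef p *: \prod_(z <- zeros p) ('X - z%:P).
Proof. exact: (svalP (closed_field_poly_normal p)). Qed.

Lemma size_zeros p : p != 0 -> size (zeros p) = (size p).-1.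
Proof.
move=> p0; rewrite [in RHS](zeros_factor p) size_scale ?lead_coef_eq0//.
by rewrite size_prod_XsubC.
Qed.

Lemma zero_counting_measureE p (A : set R[i]) :
  zero_counting_measure p A =
  (size p).-1%:R^-1 * (count (fun z => z \in A) (zeros p))%:R.
Proof.
rewrite /zero_counting_measure; congr (_ * _).
rewrite -sum1_count natr_sum [RHS]big_mkcond/=; apply: eq_bigr => z _.
by rewrite indicE; case: (z \in A).
Qed.

Lemma zero_counting_measure_itv p (A : set R[i]) :
  0 <= zero_counting_measure p A <= 1.
Proof.
rewrite zero_counting_measureE mulr_ge0 ?invr_ge0//=.
have [->|p0] := eqVneq p 0; first by rewrite size_poly0 invr0 mul0r.
have [->|n0] := eqVneq (size p).-1 0%N; first by rewrite invr0 mul0r.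
rewrite ler_pdivrMl ?ltr0n ?lt0n// mulr1 ler_nat -size_zeros//.
exact: count_size.
Qed.

(** Take t = y with y = sqrt x, so that D <= 3 y + Q y^2. If C y < 1 then y < 1/4, hence
    Q (1 - y) >= 1, which is 3 y + Q y^2 <= (2 + Q) y; if C y >= 1 the trivial bound
    D <= 1 suffices. *)
Lemma trade_off_le (x Q C D : R) : 0 <= x -> 2 <= Q -> 2 + Q <= C -> D <= 1 ->
  (forall t, 0 < t -> D <= 2 * t + x / t + Q * x) -> D <= C * Num.sqrt x.
Proof.
move=> x0 Q2 QC D1 hD; move: x0; rewrite le_eqVlt => /predU1P[x0|x0].
  rewrite -x0 sqrtr0 mulr0; apply/ler_addgt0Pr => e e0.
  have e2 : 0 < e / 2 by rewrite divr_gt0.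
  by have := hD _ e2; rewrite -x0 mul0r mulr0 !addr0; lra.
set y := Num.sqrt x; have y0 : 0 < y by rewrite sqrtr_gt0.
have xE : x = y * y by rewrite -expr2 sqr_sqrtr// ltW.
have [Cy|Cy] := leP 1 (C * y); first exact: le_trans Cy.
have := hD y y0; rewrite {1}xE mulfK ?gt_eqF// xE => /le_trans; apply.
have h1 : (2 + Q) * y <= C * y by rewrite ler_wpM2r// ltW.
have h2 : 4 * y < 1 by apply: le_lt_trans Cy; rewrite ler_wpM2r ?(ltW y0)//; lra.
have h3 : 2 * ((1 - y) * y) <= Q * ((1 - y) * y).
  by apply: ler_wpM2r => //; apply: mulr_ge0; lra.
have h4 : 4 * y * y <= y by rewrite ler_piMl// ltW.
lra.
Qed.

Variables (p : {poly R[i]}) (n : nat) (r a b : R).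
Hypotheses (n_gt0 : (0 < n)%N) (p_size : size p = n.+1) (p0_neq0 : p`_0 != 0).
Hypotheses (r01 : 0 < r < 1) (a_ge0 : 0 <= a) (ab : a < b) (b_lt2pi : b < 2 * pi).

(** The zeros counted by the annular sector are those in the angular sector, except
    for the zeros outside the annulus, a fraction at most 2 x / (1 - r) of them
    with x the quotient under the square root. *)
Lemma annular_sector_discrepancy :
  `|zero_counting_measure p (annular_sector r a b) - (b - a) / (2 * pi)| <=
  sector_constant r * Num.sqrt ((ln (\sum_(k < n.+1) cmod p`_k)
    - ln (cmod p`_0) / 2 - ln (cmod p`_n) / 2) / n%:R).
Proof.
have pi0 := @pi_gt0 R; have [r0 r1] := andP r01.
have p_neq0 : p != 0 by rewrite -size_poly_gt0 p_size.
set S := \sum_(k < _) _; set zs := zeros p; set c := lead_coef p.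
have cE : c = p`_n by rewrite /c lead_coefE p_size.
have c0 : c != 0 by rewrite lead_coef_eq0.
have zs_size : size zs = n by rewrite size_zeros ?p_size.
have p_eval z : cmod p.[z] = cmod c * \prod_(w <- zs) cmod (z - w).
  rewrite {1}(zeros_factor p) hornerZ cmodM horner_prod cmod_prod.
  by congr (_ * _); apply: eq_bigr => w _; rewrite !hornerE.
have p0E : cmod p`_0 = cmod c * \prod_(w <- zs) cmod w.
  rewrite -horner_coef0 p_eval; congr (_ * _); apply: eq_bigr => w _.
  by rewrite sub0r cmodN.
have zs0 z : z \in zs -> z != 0.
  move=> zzs; apply: contra_neq p0_neq0 => z0; apply/eqP.
  rewrite -cmod_eq0 p0E mulf_eq0 prodf_seq_eq0; apply/orP; right.
  by apply/hasP; exists z => //=; rewrite z0 cmod0.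
have S0 : 0 < S.
  rewrite /S big_ord_recl/= ltr_wpDr ?cmod_gt0//.
  by apply: sumr_ge0 => k _; exact: cmod_ge0.
have circ z : cmod z = 1 -> cmod c * \prod_(w <- zs) cmod (z - w) <= S.
  move=> z1; rewrite -p_eval horner_coef p_size (le_trans (le_cmod_sum _ _ _))//.
  by apply: ler_sum => k _; rewrite cmodM cmodX z1 expr1n mulr1.
set H := ln S - _ - _; have HE : H = log_excess c zs S.
  rewrite /H /log_excess p0E -cE lnM ?posrE ?cmod_gt0//; last first.
    rewrite big_seq prodr_gt0// => w /zs0; by rewrite cmod_gt0.
  rewrite ln_prod; last by move=> w /zs0; rewrite cmod_gt0.
  by move: (ln _) (ln _) (\sum_(_ <- _) _) => *; field.
have H0 : 0 <= H by rewrite HE (log_excess_ge0 c0 zs0 S0 circ).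
have n0 : 0 < n%:R :> R by rewrite ltr0n.
have Q2 : 2 <= 2 / (1 - r).
  by rewrite ler_pdivlMr ?subr_gt0// ler_piMr// lerBlDr lerDl ltW.
set q := (b - a) / (2 * pi).
have q01 : 0 <= q <= 1.
  rewrite divr_ge0 ?subr_ge0 ?(ltW ab) ?mulr_ge0 ?(ltW pi0)//=.
  rewrite ler_pdivrMr ?mulr_gt0// mul1r lerBlDr (le_trans (ltW b_lt2pi))//.
  by rewrite lerDl.
apply: (@trade_off_le _ (2 / (1 - r))) => //.
- by rewrite divr_ge0// ltW.
- exact: sector_constant_ge.
- have /andP[m0 m1] := zero_counting_measure_itv p (annular_sector r a b).
  by rewrite ler_norml; lra.
move=> t t0; rewrite zero_counting_measureE p_size -/zs /=.
pose inS (z : R[i]) := a <= arg z < b.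
pose out (z : R[i]) := ~~ (r < cmod z < r^-1).
set cnt := count _ zs.
have ab' : 0 <= a <= b by rewrite a_ge0 ltW.
have up := sector_count_le c0 zs0 S0 circ ab' t0.
have lo := sector_count_ge c0 zs0 S0 circ ab' (ltW b_lt2pi) t0.
have ou := outside_annulus_count_le c0 zs0 circ r01.
rewrite -/inS -HE zs_size -/q in up lo; rewrite -/out -HE in ou.
have memE z : (z \in annular_sector r a b) = ~~ out z && inS z.
  rewrite /out negbK /inS; apply/idP/idP; first by rewrite inE => -[-> ->].
  by move=> /andP[z1 z2]; rewrite inE.
have cnt_le : (cnt <= count inS zs)%N.
  by apply: sub_count => z /=; rewrite memE => /andP[].
have cnt_ge : (count inS zs <= cnt + count out zs)%N.
  rewrite /cnt -count_predUI (leq_trans _ (leq_addr _ _))//.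
  by apply: sub_count => z /=; rewrite memE => ->; rewrite andbT orbC orbN.
move: cnt_le cnt_ge; rewrite -!(ler_nat R) natrD => cnt_le cnt_ge.
have ou' : (count out zs)%:R <= n%:R * (2 / (1 - r) * (H / n%:R)).
  have -> : n%:R * (2 / (1 - r) * (H / n%:R)) = 2 * H / (1 - r).
    by field; rewrite !gt_eqF ?subr_gt0.
  by rewrite ler_pdivlMr ?subr_gt0.
have HtE : H / t = n%:R * (H / n%:R / t) by field; rewrite !gt_eqF.
rewrite HtE in up lo.
set x := H / n%:R in ou' up lo *; set v := x / t in up lo *.
set Qx := _ * x in ou' *.
rewrite -(ler_pM2l n0) -{1}(gtr0_norm n0) -normrM mulrBr mulVKf ?gt_eqF//.
rewrite ler_norml; move: up lo ou' cnt_le cnt_ge; rewrite !(mulrDr n%:R) !(mulrN n%:R).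
by move: (n%:R * q) (n%:R * (2 * t)) (n%:R * v) (n%:R * Qx) => *; lra.
Qed.
End ZeroDistribution.

(** * Expectations of log-moduli *)

Section Probability.
Context (d : measure_display) (T : measurableType d) (R : realType).
Variable P : probability T R.
Local Open Scope ereal_scope.

Import HBNNSimple.

(** The zero counting measure of a random polynomial is bounded pointwise, so that
    monotonicity is needed without measurability of the smaller function: the
    integral is a supremum over the simple functions below it. *)
Lemma ge0_le_integral_nonmeasurable (f g : T -> \bar R) :
  (forall w, 0 <= f w) -> (forall w, f w <= g w) ->
  \int[P]_w f w <= \int[P]_w g w.
Proof.
move=> f0 fg; have g0 w : 0 <= g w by exact: le_trans (fg w).
rewrite !ge0_integralTE//; apply: le_ereal_sup => _ [h hf <-].
by exists h => // w; exact: le_trans (fg w).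
Qed.

Variable X : T -> R[i].
Hypothesis X_rv : complex_random_variable X.

Lemma measurable_cmod : measurable_fun setT (fun w => cmod (X w)).
Proof.
have [mRe mIm] := X_rv.
rewrite (_ : (fun w => _) = (@Num.sqrt R) \o
    (fun w => complex.Re (X w) ^+ 2 + complex.Im (X w) ^+ 2)%R); last first.
  by apply/funext => w /=; case: (X w).
apply: measurableT_comp; last by apply: measurable_funD; exact: measurable_funX.
by apply: continuous_measurable_fun; exact: sqrt_continuous.
Qed.

Lemma measurable_lne_cmod : measurable_fun setT (fun w => lne (cmod (X w))%:E).
Proof.
rewrite /lne; apply: measurable_fun_ifT => //.
- by apply: measurable_fun_ler => //; exact: measurable_cmod.
- apply/measurable_EFinP; apply: measurableT_comp; last exact: measurable_cmod.
  exact: measurable_ln.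
Qed.

Hypothesis X_mean : 'E_P[fun w => cmod (X w)] < +oo.

Lemma integrable_cmod : P.-integrable setT (fun w => (cmod (X w))%:E).
Proof.
apply/integrableP; split; first by apply/measurable_EFinP; exact: measurable_cmod.
move: X_mean; rewrite unlock; congr (_ < _); apply: eq_integral => w _.
by rewrite gee0_abs// lee_fin cmod_ge0.
Qed.

Lemma lne_cmod_le w : lne (cmod (X w))%:E <= (cmod (X w))%:E.
Proof. by rewrite ltW// lne_sublinear. Qed.

Hypothesis X_log : -oo < expectation_log_cmod P X.

Lemma integrable_lne_cmod : P.-integrable setT (fun w => lne (cmod (X w))%:E).
Proof.
set L := fun w => _; have mL : measurable_fun setT L by exact: measurable_lne_cmod.
have pos_fin : \int[P]_w (L ^\+ w) < +oo.
  have /integrableP[_] := integrable_cmod; apply: le_lt_trans.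
  apply: ge0_le_integral_nonmeasurable => w; first exact: funepos_ge0.
  rewrite funeposE gee0_abs ?lee_fin ?cmod_ge0// ge_max lne_cmod_le/=.
  by rewrite lee_fin cmod_ge0.
have neg_fin : \int[P]_w (L ^\- w) < +oo.
  rewrite ltey; apply: contraTN X_log => /eqP neg_oo.
  rewrite -leNgt /expectation_log_cmod integralE -/L neg_oo.
  by move: pos_fin; case: (integral _ _ _).
apply/integrableP; split => //.
under eq_integral do rewrite -/((abse \o L) _) fune_abse.
rewrite ge0_integralD//; last 2 first.
- exact: measurable_funepos.
- exact: measurable_funeneg.
exact: lte_add_pinfty.
Qed.

Lemma expectation_log_cmod_fin_num : expectation_log_cmod P X \is a fin_num.
Proof. exact: integrable_fin_num integrable_lne_cmod. Qed.

Lemma expectation_log_cmod_le :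
  expectation_log_cmod P X <= 'E_P[fun w => cmod (X w)].
Proof.
rewrite unlock; apply: le_integral => //; first exact: integrable_lne_cmod.
  exact: integrable_cmod.
by move=> w _; exact: lne_cmod_le.
Qed.
End Probability.

(** * Random polynomials *)

Section RandomPolynomial.
Context (d : measure_display) (T : measurableType d) (R : realType).
Variables (P : probability T R) (A : nat -> T -> R[i]).
Variables (r a b : R).
Hypotheses (r01 : 0 < r < 1) (a_ge0 : 0 <= a) (ab : a < b) (b_lt2pi : b < 2 * pi).

Definition discrepancy n w : R :=
  `|zero_counting_measure (random_poly A n w) (annular_sector r a b)
    - (b - a) / (2 * pi)|.

Lemma coef_random_poly n w k : (k <= n)%N -> (random_poly A n w)`_k = A k w.
Proof.
move=> kn; rewrite /random_poly coef_sum (bigD1 (inord k))//= inordK//.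
rewrite coefZ coefXn eqxx mulr1 big1 ?addr0// => i ik.
rewrite coefZ coefXn; case: eqP => [ki|]; last by rewrite mulr0.
by case/eqP: ik; apply/val_inj; rewrite /= inordK.
Qed.

Lemma size_random_poly n w : A n w != 0 -> size (random_poly A n w) = n.+1.
Proof.
move=> An; apply/eqP; rewrite eqn_leq; apply/andP; split.
  apply: (leq_trans (size_sum _ _ _)); apply/bigmax_leqP => k _.
  by rewrite (leq_trans (size_scale_leq _ _))// size_polyXn.
rewrite ltnNge; apply: contra An => /leq_sizeP/(_ n (leqnn n)).
by rewrite coef_random_poly// => ->.
Qed.

Lemma sector_constant_gt0 : 0 < sector_constant r.
Proof.
apply: lt_le_trans (sector_constant_ge r).
by rewrite addr_gt0// divr_gt0// subr_gt0; case/andP: r01.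
Qed.

(** The square root and the log of the sum of the coefficients are replaced by
    tangent lines, so that taking expectations only involves the moduli of the
    coefficients and log |A_0|, log |A_n|. *)
Lemma discrepancy_le_affine n w (mu lam : R) : (0 < n)%N -> 0 < mu -> 0 < lam ->
  A 0 w != 0 -> A n w != 0 ->
  discrepancy n w <= sector_constant r / 2 *
    (((\sum_(k < n.+1) cmod (A k w)) / mu + ln mu - 1
      - ln (cmod (A 0 w)) / 2 - ln (cmod (A n w)) / 2) / (n%:R * lam) + lam).
Proof.
move=> n0 mu0 lam0 A0 An; set p := random_poly A n w.
have n0' : 0 < n%:R :> R by rewrite ltr0n.
have p0 : p`_0 = A 0 w by rewrite coef_random_poly.
have pn : p`_n = A n w by rewrite coef_random_poly.
have := @annular_sector_discrepancy R p n r a b n0 (size_random_poly An).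
rewrite p0 pn => /(_ A0 r01 a_ge0 ab b_lt2pi).
rewrite (eq_bigr (fun k : 'I_n.+1 => cmod (A k w))); last first.
  by move=> k _; rewrite coef_random_poly// -ltnS.
set S := \sum_(k < _) _; set h := ln S - _ - _.
have S_ge (k : 'I_n.+1) : cmod (A k w) <= S.
  by rewrite /S (bigD1 k)//= lerDl sumr_ge0// => i _; exact: cmod_ge0.
have SA0 := S_ge ord0; have SAn := S_ge ord_max; rewrite /= in SA0 SAn.
have S0 : 0 < S by apply: lt_le_trans SA0; rewrite cmod_gt0.
have h0 : 0 <= h.
  move: SA0 SAn; rewrite -ler_ln ?posrE ?cmod_gt0// => h1.
  by rewrite -ler_ln ?posrE ?cmod_gt0// /h; lra.
move=> /le_trans; apply.
rewrite -mulrA ler_pM2l ?sector_constant_gt0//.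
have hS : ln S <= S / mu + ln mu - 1.
  have : ln (1 + (S / mu - 1)) <= S / mu - 1.
    by apply: le_ln1Dx; rewrite ltrBrDr addrC subrr divr_gt0.
  rewrite addrCA subrr addr0.
  by rewrite ln_div ?posrE// => h1; lra.
set y := Num.sqrt _; have y0 : 0 <= y by exact: sqrtr_ge0.
have yE : y ^+ 2 = h / n%:R by rewrite sqr_sqrtr// divr_ge0// ltW.
apply: (@le_trans _ _ (2^-1 * (y ^+ 2 / lam + lam))).
  rewrite -subr_ge0 (_ : _ - _ = (y - lam) ^+ 2 / (2 * lam)).
    by rewrite divr_ge0 ?sqr_ge0 ?mulr_ge0// ltW.
  by field; rewrite gt_eqF.
rewrite ler_pM2l ?invr_gt0// lerD2r yE -mulrA -invfM ler_pM2r ?invr_gt0 ?mulr_gt0//.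
by rewrite /h; lra.
Qed.

Hypothesis A_rv : forall k, complex_random_variable (A k).
Variable M : R.
Hypothesis A_mean : forall k, ('E_P[fun w => cmod (A k w)] <= M%:E)%E.
Hypothesis A_log : forall k, (-oo < expectation_log_cmod P (A k))%E.

Let l k := fine (expectation_log_cmod P (A k)).

Local Open Scope ereal_scope.

Lemma A_mean_lt_pinfty k : 'E_P[fun w => cmod (A k w)] < +oo.
Proof. exact: le_lt_trans (A_mean k) (ltry _). Qed.

Lemma expectation_log_cmodE k : (l k)%:E = \int[P]_w lne (cmod (A k w))%:E.
Proof.
rewrite /l fineK//.
exact: (expectation_log_cmod_fin_num (A_rv k) (A_mean_lt_pinfty k) (A_log k)).
Qed.

(** The affine pointwise bound extends to every outcome as an inequality in the
    extended reals: where A_0 or A_n vanishes, its right-hand side is +oo. *)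
Lemma expectation_discrepancy_le n (mu lam : R) : (0 < n)%N -> (0 < mu)%R -> (0 < lam)%R ->
  (n.+1%:R * M <= mu)%R ->
  'E_P[discrepancy n] <= (sector_constant r / 2 *
    ((ln mu - l 0 / 2 - l n / 2) / (n%:R * lam) + lam))%:E.
Proof.
move=> n0 mu0 lam0 Mmu; have n0' : (0 < n%:R :> R)%R by rewrite ltr0n.
have C0 := sector_constant_gt0; set C := sector_constant r in C0 *.
pose K0 := (C / 2 * ((ln mu - 1) / (n%:R * lam) + lam))%R.
pose K1 := (C / 2 / (n%:R * lam) / mu)%R.
pose K2 := (- (C / 2 / (n%:R * lam) / 2))%R.
have K1_ge0 : (0 <= K1)%R by rewrite !divr_ge0 ?mulr_ge0// ltW.
have K2_lt0 : (K2 < 0)%R by rewrite oppr_lt0 !divr_gt0// mulr_gt0.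
pose Sw w := \sum_(k < n.+1) (cmod (A k w))%:E.
pose Lw w := lne (cmod (A 0 w))%:E + lne (cmod (A n w))%:E.
pose G w := K0%:E + (K1%:E * Sw w + K2%:E * Lw w).
have iL k := integrable_lne_cmod (A_rv k) (A_mean_lt_pinfty k) (A_log k).
have iC k := integrable_cmod (A_rv k) (A_mean_lt_pinfty k).
have iS : P.-integrable setT Sw by apply: integrable_sum => // k _; exact: iC.
have iLw : P.-integrable setT Lw by apply: integrableD.
have iK1 : P.-integrable setT (fun w => K1%:E * Sw w) by exact: integrableZl.
have iK2 : P.-integrable setT (fun w => K2%:E * Lw w) by exact: integrableZl.
have iK0 : P.-integrable setT (fun=> K0%:E) by exact: finite_measure_integrable_cst.
have SwE w : Sw w = (\sum_(k < n.+1) cmod (A k w))%:E by rewrite /Sw sumEFin.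
apply: (@le_trans _ _ (\int[P]_w G w)).
  rewrite unlock; apply: ge0_le_integral_nonmeasurable => w.
    by rewrite lee_fin normr_ge0.
  rewrite /G SwE -EFinM.
  have [A0|A0] := eqVneq (A 0 w) 0%R.
    rewrite (_ : Lw w = -oo) ?lt0_muleNy ?lte_fin ?leey//.
    by rewrite /Lw A0 cmod0 le0_lneNy.
  have [An|An] := eqVneq (A n w) 0%R.
    rewrite (_ : Lw w = -oo) ?lt0_muleNy ?lte_fin ?leey//.
    by rewrite /Lw An cmod0 [X in _ + X]le0_lneNy// addeNy.
  rewrite /Lw !lne_EFin ?cmod_gt0// -(EFinD (ln (cmod (A 0 w)))).
  rewrite -(EFinM K2) -!EFinD lee_fin.
  apply: le_trans (discrepancy_le_affine n0 mu0 lam0 A0 An) _.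
  rewrite le_eqVlt; apply/orP; left; apply/eqP; rewrite /K0 /K1 /K2 -/C.
  by field; rewrite !gt_eqF.
rewrite /G integralD//=; last by apply: integrableD.
rewrite integralD//= integralZl// integralZl// integral_cst//= probability_setT mule1.
rewrite /Lw integralD// -!expectation_log_cmodE.
have Sint : \int[P]_w Sw w <= mu%:E.
  rewrite /Sw integral_sum//; apply: (@le_trans _ _ (\sum_(k < n.+1) M%:E)).
    by apply: lee_sum => k _; have := A_mean k; rewrite unlock.
  by rewrite sumEFin lee_fin sumr_const card_ord -[(M *+ _)%R]mulr_natl.
apply: (@le_trans _ _ (K0%:E + (K1%:E * mu%:E + K2%:E * ((l 0)%:E + (l n)%:E)))).
  by rewrite leeD2l// leeD2r// lee_wpmul2l// lee_fin.
rewrite -!EFinM -!EFinD lee_fin le_eqVlt; apply/orP; left; apply/eqP.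
by rewrite /K0 /K1 /K2; field; rewrite !gt_eqF.
Qed.
End RandomPolynomial.

Unset Implicit Arguments.

Theorem theorem5p2 (R : realType) (d : measure_display) (T : measurableType d)
  (P : probability T R) (A : nat -> T -> R[i])
  (A_rv : forall k, complex_random_variable (A k))
  (A_mean : (ereal_sup (range (fun k : nat =>
     'E_P[fun w => cmod (A k w)])) < +oo)%E)
  (A_var : (ereal_sup (range (fun k : nat =>
     'V_P[fun w => cmod (A k w)])) < +oo)%E)
  (A_log0 : (-oo < expectation_log_cmod P (A 0%N))%E)
  (A_log : forall n : nat, (-oo < expectation_log_cmod P (A n))%E)
  (r a b : R) (r01 : 0 < r < 1) (a_ge0 : 0 <= a) (ab : a < b)
  (b_lt2pi : b < 2 * pi) :
  exists2 e : nat -> R, e =O_\oo (fun _ : nat => 1 : R) &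
    \forall n \near \oo,
      ('E_P[fun w => `|zero_counting_measure (random_poly A n w)
                         (annular_sector r a b) - (b - a) / (2 * pi)|%R]
       <= (sector_constant r *
           Num.sqrt ((3 / 2 * ln n.+1%:R
                      - 1 / 2 * fine (expectation_log_cmod P (A 0%N))
                      - 1 / 2 * fine (expectation_log_cmod P (A n))
                      + e n) / n%:R))%:E)%E.
Proof.
have [M M1 A_le] : exists2 M : R, 1 <= M &
    forall k, ('E_P[fun w => cmod (A k w)] <= M%:E)%E.
  move: A_mean; set u := ereal_sup _ => u_lt.
  have : forall k, ('E_P[fun w => cmod (A k w)] <= u)%E.
    by move=> k; apply: ereal_sup_ubound; exists k.
  case: u u_lt => [s| |] // _ supP.
    exists (Num.max 1 s); first by rewrite le_max lexx.
    by move=> k; rewrite (le_trans (supP k))// lee_fin le_max lexx orbT.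
  by exists 1 => // k; rewrite (le_trans (supP k))// leNye.
have M0 : 0 < M by exact: lt_le_trans M1.
(* ln M accounts for the mean of the sum of the moduli; M + 1 keeps the radicand
   positive, since E[log|A_k|] <= M. *)
exists (fun=> ln M + M + 1).
  by apply/eqO_exP; exists (`|ln M + M + 1| + 1); [rewrite ltr_pwDr|
    near=> n; rewrite normr1 mulr1 lerDl].
near=> n; have n0 : (0 < n)%N by near: n; exact: nbhs_infty_gt.
have n0' : 0 < n%:R :> R by rewrite ltr0n.
set l0 := fine (expectation_log_cmod P (A 0%N)); set ln' := fine (expectation_log_cmod P (A n)).
have l_le k : fine (expectation_log_cmod P (A k)) <= M.
  have h := expectation_log_cmod_fin_num (A_rv k) (A_mean_lt_pinfty A_le k) (A_log k).
  rewrite -lee_fin fineK// (le_trans _ (A_le k))//.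
  exact: (expectation_log_cmod_le (A_rv k) (A_mean_lt_pinfty A_le k) (A_log k)).
have l0M : l0 <= M := l_le 0%N; have lnM' : ln' <= M := l_le n.
have lnM0 : 0 <= ln M by rewrite ln_ge0.
have lnn : 0 <= ln (n.+1%:R : R) by rewrite ln_ge0// ler1n.
set V := (X in Num.sqrt (X / _)).
have V0 : 0 < V by rewrite /V; lra.
(* The tangent point at which the affine bound gives back the square root. *)
pose lam := Num.sqrt (V / n%:R); have lam0 : 0 < lam by rewrite sqrtr_gt0 divr_gt0.
have lamE : V / n%:R = lam * lam by rewrite -expr2 sqr_sqrtr// ltW// divr_gt0.
have mu0 : 0 < n.+1%:R * M :> R by rewrite mulr_gt0.
have := expectation_discrepancy_le r01 a_ge0 ab b_lt2pi A_rv A_le A_log n0 mu0 lam0 (lexx _).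
rewrite /discrepancy -/l0 -/ln' => /le_trans; apply.
rewrite lee_fin -/lam -mulrA ler_pM2l ?sector_constant_gt0//.
rewrite lnM ?posrE//.
have : (ln n.+1%:R + ln M - l0 / 2 - ln' / 2) / (n%:R * lam) <= V / (n%:R * lam).
  by rewrite ler_pM2r ?invr_gt0 ?mulr_gt0// /V; lra.
rewrite invfM [X in _ <= X -> _]mulrA lamE mulfK ?gt_eqF// => h.
lra.
Unshelve. all: by end_near. Qed.
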